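(* Let $K$ be a field of characteristic zero and $r\ge2$. Let $P(\underline u,y)=\sum_{\underline i\in\mathbb N^r}\sum_{j=0}^{d_y}a_{\underline i,j}\underline u^{\underline i}y^j\in K[[\underline u]][y]\setminus\{0\}$ be a polynomial with $\deg_y(P)\le d_y$ and with only simple roots, and let $y_0=\sum_{\underline n\in\mathbb N^r}c_{\underline n}\underline u^{\underline n}\in K[[\underline u]]$, $c_{\underline0}\neq0$, be a root of $P$ which is not a polynomial. Let $\underline k\in\mathbb N^r$ be such that $|\underline k|\ge\mathrm{ord}_{\underline u}(\Delta_P(\underline u))+1$. For any $\underline p\in\mathbb N^r$ with $\underline p>_{\mathrm{grlex}}S(\underline k)$, put $\underline n:=\underline p-S(\underline k)$. Then $$c_{\underline p}=c_{S(\underline k)+\underline n}=\sum_{q=1}^{\mu_{\underline n}}\frac1q\left(\frac{-1}{\omega_0}\right)^q\sum_{|\underline S|=q,\ \|\underline S\|\ge q-1}\underline A^{\underline S}\left(\sum_{\substack{|\underline T_{\underline S}|=\|\underline S\|-q+1\\ g(\underline T_{\underline S})=\underline n+q\,\underline i_{\underline k}-(q-1)S(\underline k)-g(\underline S)}}e_{\underline T_{\underline S}}\,\underline C^{\underline T_{\underline S}}\right),$$ where $\underline S=(s_{\underline i,j})_{\underline i\in\mathbb N^r,\,0\le j\le d_y}$ ranges over families of nonnegative integers with finite support, $\underline T_{\underline S}=(t_{\underline S,\underline i})_{\underline 0\le_{\mathrm{grlex}}\underline i\le_{\mathrm{grlex}}S(\underline k)}$ over tuples of nonnegative integers, $\underline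 A^{\underline S}=\prod_{\underline i,j}a_{\underline i,j}^{s_{\underline i,j}}$, $\underline C^{\underline T_{\underline S}}=\prod_{\underline i\le_{\mathrm{grlex}}S(\underline k)}c_{\underline i}^{t_{\underline S,\underline i}}$, and $e_{\underline T_{\underline S}}\in\mathbb N$ is $$e_{\underline T_{\underline S}}=\sum_{(n^{\underline l,m}_{\underline i,j,\underline L})}\ \frac{q!}{\prod n^{\underline l,m}_{\underline i,j,\underline L}!}\ \prod\left(\frac{j!}{m!\,\underline L!}\right)^{n^{\underline l,m}_{\underline i,j,\underline L}}.$$ Here both products are over the indices $(\underline l,m,\underline i,j,\underline L)$ with: $\underline l\in\mathbb Z^r$, $\underline l+\underline i_{\underline k}\in\mathbb N^r$, $\underline l\ge_{\mathrm{grlex}}S(\underline i_{\underline k})-\underline i_{\underline k}$; $0\le m\le m_{\underline l}$, where $m_{\underline l}:=\min\{d_y,\ \max\{m\in\mathbb N\mid mS(\underline k)\le_{\mathrm{grlex}}\underline l+\underline i_{\underline k}\}\}$; $\underline i\in\mathbb N^r$ with $\underline i\le\underline l+\underline i_{\underline k}-mS(\underline k)$ componentwise; $m\le j\le d_y$; $\underline L=(l_{\underline 0},\dots,l_{S(\underline k)})$ a tuple of nonnegative integers indexed by $\{\underline i\in\mathbb N^r\mid\underline i\le_{\mathrm{grlex}}S(\underline k)\}$ with $|\underline L|=j-m$ and $g(\underline L)=\underline l+\underline i_{\underline k}-mS(\underline k)-\underline i$. The sum is over all families $(n^{\underline l,m}_{\underline i,j,\underline L})$ of nonnegative integers with finite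 support, indexed by these indices, such that $$\sum_{\underline l,m}\sum_{\underline L}n^{\underline l,m}_{\underline i,j,\underline L}=s_{\underline i,j}\ \text{ for all }(\underline i,j),\qquad \sum_{\underline l,m}\sum_{\underline i,j}\sum_{\underline L}n^{\underline l,m}_{\underline i,j,\underline L}=q,\qquad \sum_{\underline l,m}\sum_{\underline i,j}\sum_{\underline L}n^{\underline l,m}_{\underline i,j,\underline L}\,\underline L=\underline T_{\underline S}$$ (an empty sum being $0$).
   Context: For $\underline n\in\mathbb Z^r$, $|\underline n|=n_1+\cdots+n_r$; $\underline n<_{\mathrm{grlex}}\underline m$ iff $|\underline n|<|\underline m|$, or $|\underline n|=|\underline m|$ and $\underline n<_{\mathrm{lex}}\underline m$; $\le$ without subscript is the componentwise order on $\mathbb Z^r$. $S(\underline k)$ is the successor of $\underline k$ in $(\mathbb N^r,\le_{\mathrm{grlex}})$, $\mathbb N=\mathbb Z_{\ge0}$, $S^2=S\circ S$. For a Laurent-type series $s$ in $\underline u$, $w(s)$ is the $\le_{\mathrm{grlex}}$-minimum of its support; for a polynomial $Q=\sum_ja_jy^j$, $w(Q)=\min_jw(a_j)$. $\mathrm{ord}_{\underline u}$ is the $(\underline u)$-adic order. $\Delta_P$ is the resultant with respect to $y$ of $P$ and $\partial P/\partial y$; ''only simple roots'' means that all roots of $P$ in an algebraic closure of $K((\underline u))$ are simple (so $\Delta_P\ne0$). Families: for $\underline m=(m_{\underline i,j})$ with finite support, $|\underline m|=\sum m_{\underline i,j}$, $\|\underline m\|=\sum j\,m_{\underline i,j}$,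 $g(\underline m)=\sum m_{\underline i,j}\,\underline i$. For tuples $\underline T=(t_{\underline i})$ indexed by $\underline i\in\mathbb N^r$: $|\underline T|=\sum t_{\underline i}$, $g(\underline T)=\sum t_{\underline i}\,\underline i$, $\underline T!=\prod t_{\underline i}!$. Convention $0^0=1$. For $\underline k\in\mathbb N^r$: $z_{\underline k}:=\sum_{\underline n\le_{\mathrm{grlex}}\underline k}c_{\underline n}\underline u^{\underline n}$; $P_{\underline k}(\underline u,y):=P(\underline u,z_{\underline k}+\underline u^{S(\underline k)}y)$; $\underline i_{\underline k}:=w(P_{\underline k})$; $P_{\underline k}(\underline u,y)=\sum_{\underline i\ge_{\mathrm{grlex}}\underline i_{\underline k}}\pi^P_{\underline k,\underline i}(y)\underline u^{\underline i}$ with $\pi^P_{\underline k,\underline i}\in K[y]$. $\underline k_0$ is the $\le_{\mathrm{grlex}}$-least multi-index with $\underline i_{S(\underline k_0)}=\underline i_{\underline k_0}-S(\underline k_0)+S^2(\underline k_0)$ (it exists since $y_0$ is a simple root), and $\omega_0:=(\pi^P_{\underline k_0,\underline i_{\underline k_0}})'(c_{S(\underline k_0)})\ne0$. Define ${}_{\underline k}Q(\underline u,y)=\sum_{\underline l,m}b_{\underline l,m}\underline u^{\underline l}y^m$ by $\frac{P_{\underline k}(\underline u,y+c_{S(\underline k)})}{-\omega_0\underline u^{\underline i_{\underline k}}}=-y+{}_{\underline k}Q(\underline u,y)$. Then $\mu_{\underline n}$ is the greatest integer $m$ for which there is a family $\underline M=(m_{\underline l,j})$ of nonnegative integers with finite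 support, supported on pairs $(\underline l,j)$ with $b_{\underline l,j}\ne0$, such that $|\underline M|=m$, $\|\underline M\|=m-1$, $g(\underline M)=\underline n$ (and $\mu_{\underline n}:=0$ if there is none). *)

(* Defs.v *)
From HB Require Import structures.
From mathcomp Require Import all_boot all_order all_algebra finmap.
From mathcomp Require Import mpoly.
From mathcomp Require Import boolp classical_sets fsbigop.

Set Implicit Arguments.
Unset Strict Implicit.
Unset Printing Implicit Defensive.

Import Order.TTheory GRing.Theory.

Local Open Scope ring_scope.

(* K[[u_1, ..., u_r]].  Exponents are multinomials' 'X_{1..r}, whose canonical
   order (_ <= _)%O is the graded lexicographic one (see zgrlex_lt_nat). *)

Record mfps (r : nat) (K : Type) := MFPS { mfps_coef :> 'X_{1..r} -> K }.

Section Ring.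
Variables (r : nat) (K : fieldType).
Local Notation fps := (mfps r K).
Implicit Types (s t u : fps) (m : 'X_{1..r}).

HB.instance Definition _ := gen_eqMixin fps.
HB.instance Definition _ := gen_choiceMixin fps.

Lemma mfpsP s t : (forall m, s m = t m) <-> s = t.
Proof.
split=> [|-> //]; case: s t => [f] [g] /= fg.
by congr MFPS; apply/funext.
Qed.

Definition mfps_zero : fps := MFPS (fun=> 0).
Definition mfps_opp s : fps := MFPS (fun m => - s m).
Definition mfps_add s t : fps := MFPS (fun m => s m + t m).
Definition mfps_const (c : K) : fps := MFPS (fun m => c *+ (m == 0%MM)).
Definition mfps_mono (e : 'X_{1..r}) : fps := MFPS (fun m => (m == e)%:R).
Definition mfps_mul s t : fps :=
  MFPS (fun m => \sum_(e : 'X_{1..r < (mdeg m).+1, (mdeg m).+1}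
                        | m == (e.1 + e.2)%MM) s e.1 * t e.2).

Lemma mfps_addA : associative mfps_add.
Proof. by move=> s t u; apply/mfpsP => m /=; rewrite addrA. Qed.
Lemma mfps_addC : commutative mfps_add.
Proof. by move=> s t; apply/mfpsP => m /=; rewrite addrC. Qed.
Lemma mfps_add0 : left_id mfps_zero mfps_add.
Proof. by move=> s; apply/mfpsP => m /=; rewrite add0r. Qed.
Lemma mfps_addN : left_inverse mfps_zero mfps_opp mfps_add.
Proof. by move=> s; apply/mfpsP => m /=; rewrite addNr. Qed.

HB.instance Definition _ :=
  GRing.isZmodule.Build fps mfps_addA mfps_addC mfps_add0 mfps_addN.

(* The ring axioms are transported from {mpoly K[r]} by truncation. *)
Definition mfps_trunc d s : {mpoly K[r]} :=
  \sum_(m : 'X_{1..r < d}) (s m *: 'X_[m]).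

Lemma mcoeff_trunc d s m : (mdeg m < d)%N -> (mfps_trunc d s)@_m = s m.
Proof. by move=> md; rewrite /mfps_trunc (mcoeff_mpoly s md). Qed.

Lemma eq_mcoeffM (p q p' q' : {mpoly K[r]}) m :
    (forall e, (mdeg e <= mdeg m)%N -> p@_e = p'@_e) ->
    (forall e, (mdeg e <= mdeg m)%N -> q@_e = q'@_e) ->
  (p * q)@_m = (p' * q')@_m.
Proof.
move=> pp' qq'; rewrite !mcoeffM; apply: eq_bigr => -[e1 e2] /= _.
by rewrite pp' ?qq' // -ltnS bmdeg.
Qed.

Lemma mfps_mulE d s t m : (mdeg m < d)%N ->
  mfps_mul s t m = (mfps_trunc d s * mfps_trunc d t)@_m.
Proof.
move=> md; rewrite mcoeffM /=; apply: eq_bigr => -[e1 e2] /= _.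
by rewrite !mcoeff_trunc // (leq_trans _ md) // bmdeg.
Qed.

Lemma mfps_mulA : associative mfps_mul.
Proof.
move=> s t u; apply/mfpsP => m; pose d := (mdeg m).+1.
rewrite !(@mfps_mulE d) //.
transitivity (mfps_trunc d s * (mfps_trunc d t * mfps_trunc d u))@_m.
  apply: eq_mcoeffM => // e em.
  by rewrite mcoeff_trunc ?ltnS // (@mfps_mulE d) ?ltnS.
rewrite mulrA; apply: eq_mcoeffM => // e em.
by rewrite mcoeff_trunc ?ltnS // (@mfps_mulE d) ?ltnS.
Qed.

Lemma mfps_mulC : commutative mfps_mul.
Proof.
by move=> s t; apply/mfpsP => m; rewrite !(@mfps_mulE (mdeg m).+1) // mulrC.
Qed.

Lemma mfps_mul1 : left_id (mfps_const 1) mfps_mul.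
Proof.
move=> s; apply/mfpsP => m; pose d := (mdeg m).+1.
rewrite (@mfps_mulE d) // -[RHS](@mcoeff_trunc d) // -[in RHS](mul1r (mfps_trunc d s)).
apply: eq_mcoeffM => // e em.
by rewrite mcoeff_trunc ?ltnS // mcoeff1.
Qed.

Lemma mfps_mulDl : left_distributive mfps_mul mfps_add.
Proof.
move=> s t u; apply/mfpsP => m /=; rewrite -big_split /=.
by apply: eq_bigr => e _; rewrite mulrDl.
Qed.

Lemma mfps_1neq0 : mfps_const 1 != 0.
Proof.
apply/eqP => /(congr1 (fun s : fps => s 0%MM)) /=.
by rewrite eqxx; apply/eqP/oner_neq0.
Qed.

HB.instance Definition _ := GRing.Zmodule_isComNzRing.Build fps
  mfps_mulA mfps_mulC mfps_mul1 mfps_mulDl mfps_1neq0.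

Definition mfps_unit : {pred fps} := [pred s | `[< exists t, t * s = 1 >]].
Definition mfps_inv s : fps :=
  if pselect (exists t, t * s = 1) is left ex then projT1 (cid ex) else s.

Lemma mfps_mulV : {in mfps_unit, left_inverse 1 mfps_inv *%R}.
Proof.
move=> s /asboolP ex; rewrite /mfps_inv; case: pselect => // ex'.
by case: cid.
Qed.
Lemma mfps_unitP s t : t * s = 1 -> s \in mfps_unit.
Proof. by move=> ts; apply/asboolP; exists t. Qed.
Lemma mfps_inv_out : {in [predC mfps_unit], mfps_inv =1 id}.
Proof.
move=> s /asboolP nex; rewrite /mfps_inv; by case: pselect.
Qed.

HB.instance Definition _ := GRing.ComNzRing_hasMulInverse.Build fps
  mfps_mulV mfps_unitP mfps_inv_out.

End Ring.

(* Least and greatest elements; x0 is a junk value. *)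
Section Extremum.
Variables (disp : Order.disp_t) (T : porderType disp).
Definition least (x0 : T) (A : set T) : T := xget x0 (A `&` lbound A)%classic.
Definition greatest (x0 : T) (A : set T) : T := xget x0 (A `&` ubound A)%classic.
End Extremum.

Lemma grlex_least r (A : set 'X_{1..r}) :
  (A !=set0)%classic -> A (least 0%MM A) /\ forall m, A m -> (least 0%MM A <= m)%O.
Proof.
case=> m0; elim/(ltmwf (n := r)): m0 => m IH Am.
rewrite /least; have [[m' [m'm Am']]|H] := pselect (exists m', (m' < m)%O /\ A m').
  exact: IH m'm Am'.
apply: (@xgetPex _ _ (A `&` lbound A)%classic); exists m; split=> // m' Am'.
by rewrite leNgt; apply/negP => m'm; apply: H; exists m'.
Qed.

Section Domain.
Variables (r : nat) (K : fieldType).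
Local Notation fps := (mfps r K).

Definition supp (s : fps) : set 'X_{1..r} := [set m | s m != 0]%classic.
Definition w (s : fps) : 'X_{1..r} := least 0%MM (supp s).

Lemma w_neq0 (s : fps) : s != 0 -> s (w s) != 0 /\ forall m, s m != 0 -> (w s <= m)%O.
Proof.
move=> s0; apply: (@grlex_least _ (supp s)).
apply: contrapT => H; case/eqP: s0; apply/mfpsP => m /=.
by apply: contrapT => /eqP sm; apply: H; exists m.
Qed.

Lemma mfps_idomain (s t : fps) : s * t = 0 -> (s == 0) || (t == 0).
Proof.
move=> st0; case: (eqVneq s 0) => //= s0; case: (eqVneq t 0) => //= t0.
exfalso.
have [ws sP] := w_neq0 s0; have [wt tP] := w_neq0 t0.
pose m := (w s + w t)%MM.
have/(congr1 (fun s : fps => s m)) /= := st0.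
have lt1 : (mdeg (w s) < (mdeg m).+1)%N by rewrite mdegD ltnS leq_addr.
have lt2 : (mdeg (w t) < (mdeg m).+1)%N by rewrite mdegD ltnS leq_addl.
rewrite (bigD1 (BMultinom lt1, BMultinom lt2)) //= big1 ?addr0.
  by move/eqP; rewrite mulf_eq0 (negPf ws) (negPf wt).
move=> [e1 e2] /= /andP[/eqP me ne].
apply: contrapT => /eqP; rewrite mulf_eq0 negb_or => /andP[/sP le1 /tP le2].
case/negP: ne; rewrite xpair_eqE -!val_eqE /=.
move: le1; rewrite le_eqVlt => /orP[/eqP E1|l1].
  have E2 : w t = bmnm e2 by apply: (@addmI _ (w s)); rewrite {2}E1.
  by rewrite -E1 -E2 !eqxx.
by have := ltmc_le_add l1 le2; rewrite -me ltxx.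
Qed.

HB.instance Definition _ :=
  GRing.ComUnitRing_isIntegral.Build fps mfps_idomain.

Definition ord (s : fps) : nat := least 0%N (mdeg @` supp s)%classic.

Definition is_mpoly (s : fps) : Prop :=
  exists f : {mpoly K[r]}, forall m, s m = f@_m.

End Domain.

(* K((u)), the fraction field of K[[u]] *)
Notation fpsfrac r K := {fraction (mfps r K)}.

Definition is_algebraic_closure (F : fieldType) (L : closedFieldType)
    (iota : {rmorphism F -> L}) : Prop :=
  forall x : L, algebraicOver iota x.

Section SimpleRoots.
Variables (r : nat) (K : fieldType) (L : closedFieldType).
Variable (iota : {rmorphism fpsfrac r K -> L}).
Definition only_simple_roots (P : {poly mfps r K}) : Prop :=
  let PL := map_poly (fun s => iota (tofrac s)) P in
  forall x : L, root PL x -> mup x PL = 1%N.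
End SimpleRoots.

Section IntVectors.
Variable r : nat.
Definition zvec := {ffun 'I_r -> int}.
HB.instance Definition _ := GRing.Zmodule.on zvec.
Implicit Types a b : zvec.

Definition zv (m : 'X_{1..r}) : zvec := [ffun i => (m i)%:Z].
Definition zdeg a : int := \sum_(i < r) a i.
Definition zle a b : bool := [forall i, a i <= b i].
Definition zlex_lt a b : bool :=
  [exists i : 'I_r, [forall (j : 'I_r | (j < i)%N), a j == b j] && (a i < b i)].
Definition zgrlex_lt a b : bool :=
  (zdeg a < zdeg b) || (zdeg a == zdeg b) && zlex_lt a b.
Definition zgrlex_le a b : bool := (a == b) || zgrlex_lt a b.

Lemma zdeg_zv m : zdeg (zv m) = (mdeg m)%:Z.
Proof.
rewrite /zdeg mdegE -natz natr_sum; apply: eq_bigr => i _.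
by rewrite ffunE natz.
Qed.

Lemma zgrlex_lt_nat (m n : 'X_{1..r}) : zgrlex_lt (zv m) (zv n) = (m < n)%O.
Proof.
rewrite /zgrlex_lt !zdeg_zv ltz_nat eqz_nat.
case: (ltngtP (mdeg m) (mdeg n)) => [lt|gt|eq] /=.
- by rewrite lt_mdeg_ltmc.
- by apply/esym/negbTE; rewrite -leNgt ltW // lt_mdeg_ltmc.
apply/existsP/(ltmcP eq) => [[i /andP[/forall_inP H lt]]|[i H lt]]; exists i.
- by move=> j /H; rewrite !ffunE eqz_nat => /eqP.
- by move: lt; rewrite !ffunE ltz_nat.
apply/andP; split; last by rewrite !ffunE ltz_nat.
by apply/forall_inP => j /H; rewrite !ffunE => ->.
Qed.

(* coefficient of u^l in the Laurent-type series s / u^e *)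
Definition laurent_coef (K : fieldType) (s : mfps r K) (e : 'X_{1..r}) (l : zvec) : K :=
  if zle 0 (l + zv e)
  then s [multinom absz ((l + zv e)%R i) | i < r]
  else 0.

End IntVectors.

Definition gsucc r (k : 'X_{1..r}) : 'X_{1..r} :=
  least 0%MM [set m | (k < m)%O]%classic.

Lemma gsuccP r (k : 'X_{1..r}) : (0 < r)%N ->
  (k < gsucc k)%O /\ forall m, (k < m)%O -> (gsucc k <= m)%O.
Proof.
move=> r0; apply: (@grlex_least _ [set m | (k < m)%O]%classic).
exists (k + U_(Ordinal r0))%MM => /=; apply: lt_mdeg_ltmc.
by rewrite mdegD mdeg1 addn1.
Qed.

Notation family I := {fsfun I -> nat with 0%N}.

Section Families.
Variable I : choiceType.
Definition fcard (M : family I) : nat := (\sum_(x <- finsupp M) M x)%N.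
Definition ffact (M : family I) : nat := (\prod_(x <- finsupp M) (M x)`!)%N.
Definition fgrade r (deg : I -> zvec r) (M : family I) : zvec r :=
  \sum_(x <- finsupp M) deg x *+ M x.
Definition fmono (K : fieldType) (a : I -> K) (M : family I) : K :=
  \prod_(x <- finsupp M) a x ^+ M x.
End Families.

Lemma dvdn_ffact (I : choiceType) (M : family I) : (ffact M %| (fcard M)`!)%N.
Proof.
rewrite /ffact /fcard; elim: (enum_fset (finsupp M)) => [|x s IH].
  by rewrite !big_nil.
rewrite !big_cons; apply: dvdn_trans (dvdn_mul (dvdnn _) IH) _.
set n := (\sum_(_ <- _) _)%N.
by rewrite -(@bin_fact (M x + n) (M x)) ?leq_addr // addKn dvdn_mull.
Qed.

Lemma dvdn_fact_ffact (I : choiceType) (m j : nat) (M : family I) :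
  (m <= j)%N -> fcard M = (j - m)%N -> (m`! * ffact M %| j`!)%N.
Proof.
move=> mj cM; apply: dvdn_trans (dvdn_mul (dvdnn _) (dvdn_ffact M)) _.
by rewrite cM -(bin_fact mj) dvdn_mull.
Qed.

Definition fnorm (I : choiceType) (M : family (I * nat)%type) : nat :=
  (\sum_(x <- finsupp M) x.2 * M x)%N.

Section Corollary.
Variables (r : nat) (K : fieldType).
Local Notation fps := (mfps r K).
Local Notation mon := 'X_{1..r}.

Definition wpoly (Q : {poly fps}) : mon :=
  least 0%MM [set w (Q`_j) | j in [set j : nat | Q`_j != 0]]%classic.

Variables (P : {poly fps}) (y0 : fps).
Local Notation c := (mfps_coef y0).

Definition zpart (k : mon) : fps := MFPS (fun n => if (n <= k)%O then c n else 0).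

Definition Pk (k : mon) : {poly fps} :=
  P \Po ((zpart k)%:P + (mfps_mono K (gsucc k))%:P * 'X).

Definition ik (k : mon) : mon := wpoly (Pk k).

Definition pik (k i : mon) : {poly K} :=
  \poly_(j < size (Pk k)) ((Pk k)`_j) i.

(* i_{S(k)} = i_k - S(k) + S^2(k), written without subtraction *)
Definition k0 : mon :=
  least 0%MM [set k | ik (gsucc k) + gsucc k = ik k + gsucc (gsucc k)]%MM%classic.

Definition omega0 : K := (pik k0 (ik k0))^`().[c (gsucc k0)].

(* b_{l,m}: coefficient of u^l y^m in
   y + P_k(u, y + c_{S(k)}) / (- omega0 u^{i_k}) *)
Definition bcoef (k : mon) (l : zvec r) (m : nat) : K :=
  let Q := Pk k \Po ('X + (mfps_const r (c (gsucc k)))%:P) in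
  laurent_coef Q`_m (ik k) l / (- omega0) + ((l == 0) && (m == 1%N))%:R.

Definition mu (k : mon) (n : zvec r) : nat :=
  greatest 0%N [set m : nat | exists M : family (zvec r * nat)%type,
    [/\ forall x, x \in finsupp M -> bcoef k x.1 x.2 != 0,
        fcard M = m,
        (fnorm M).+1 = m &
        fgrade (fun x => x.1) M = n]]%classic.

Definition mmax (dy : nat) (k : mon) (l : zvec r) : nat :=
  minn dy (greatest 0%N
    [set m : nat | zgrlex_le (zv (gsucc k) *+ m) (l + zv (ik k))]%classic).

Definition is_tuple_upto (k : mon) (T : family mon) : Prop :=
  forall i, i \in finsupp T -> (i <= k)%O.

Record eindex := EIndex {
  ix_l : zvec r; ix_m : nat; ix_i : mon; ix_j : nat; ix_L : family mon }.
HB.instance Definition _ := gen_eqMixin eindex.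
HB.instance Definition _ := gen_choiceMixin eindex.

Definition eindex_ok (dy : nat) (k : mon) (x : eindex) : Prop :=
  let Sk := gsucc k in
  let d := ix_l x + zv (ik k) - zv Sk *+ ix_m x in
  [/\ zle 0 (ix_l x + zv (ik k)),
      zgrlex_le (zv (gsucc (ik k)) - zv (ik k)) (ix_l x),
      (ix_m x <= mmax dy k (ix_l x))%N,
      zle (zv (ix_i x)) d &
      [/\ (ix_m x <= ix_j x <= dy)%N,
          is_tuple_upto Sk (ix_L x),
          fcard (ix_L x) = (ix_j x - ix_m x)%N &
          fgrade (@zv r) (ix_L x) = d - zv (ix_i x)]].

(* Both divisions are exact (dvdn_ffact, dvdn_fact_ffact), since |N| = q and,
   for admissible indices, m + |L| = j. *)
Definition eweight (q : nat) (N : family eindex) : nat :=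
  (q`! %/ ffact N *
   \prod_(x <- finsupp N)
      ((ix_j x)`! %/ ((ix_m x)`! * ffact (ix_L x))) ^ N x)%N.

Definition ecoef (dy : nat) (k : mon) (q : nat)
    (S : family (mon * nat)%type) (T : family mon) : nat :=
  \big[addn/0%N]_(N \in [set N : family eindex |
    [/\ forall x, x \in finsupp N -> eindex_ok dy k x,
        forall i j,
          (\sum_(x <- finsupp N | (ix_i x == i) && (ix_j x == j)) N x)%N
            = S (i, j),
        fcard N = q &
        forall i, (\sum_(x <- finsupp N) N x * ix_L x i)%N = T i]]%classic)
    eweight q N.

Definition Sindex (dy q : nat) : set (family (mon * nat)%type) :=
  [set S | [/\ forall x, x \in finsupp S -> (x.2 <= dy)%N,
               fcard S = q & (q <= (fnorm S).+1)%N]]%classic.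

Definition Tindex (k : mon) (n : zvec r) (q : nat)
    (S : family (mon * nat)%type) : set (family mon) :=
  [set T | [/\ is_tuple_upto (gsucc k) T,
               (fcard T + q = (fnorm S).+1)%N &
               fgrade (@zv r) T =
                 n + zv (ik k) *+ q - zv (gsucc k) *+ q.-1
                   - fgrade (fun x => zv x.1) S]]%classic.

End Corollary.

Arguments Sindex r dy q : clear implicits.

(* Main.v *)
(** Write [N = S(k)], [t] for the tail of [y0] beyond [N], [e = w(P'(y0))], and let [om] be the
    leading coefficient of [P'(y0)].  Evaluating the identity [Delta = A P + B P'] at [y0] gives
    [|e| <= ord Delta < |k|], so in the Taylor expansion of [P] at [y0] the linear term dominates:
    [i_k = e + N], and the initial form of [P_k] is [om (y - c_N)].  The equation defining
    [k0] forces the linear term to reach the minimum already there, whence [omega0 = om].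

    With [R(y) = P(z_N + y)] and [Q = om u^e y - R], the factorisation
    [om u^e y - Q = (y - t) (om u^e - V)] reads [1 - Q/(om u^e y) = (1 - t/y) (1 - V/(om u^e))].
    Taking [- log] and extracting the coefficient of [1/y], where [V] contributes nothing because
    it has no negative power of [y], gives [t = sum_q (1/q) [y^(q-1)] (Q/(om u^e))^q].  The
    logarithm is truncated; the error is controlled by a linear form [lam] on exponents, with
    positive integer weights, which is strictly increasing for the graded lexicographic order
    above every exponent of small degree.  The same form bounds the set defining [mu].

    Expanding [R(u^N y)] over the admissible indices and its [q]-th power by the multinomial
    formula gives a sum over finite families of indices, which is then grouped according to the
    exponents [S] of the coefficients of [P] and [T] of those of [y0]. *)

Require Import Defs.
From HB Require Import structures.
From mathcomp Require Import all_boot all_order all_algebra finmap.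
From mathcomp Require Import mpoly.
From mathcomp Require Import boolp classical_sets fsbigop.
From mathcomp Require Import zify ring.
Import Defs.

Import Num.Theory Order.TTheory GRing.Theory.
Local Open Scope ring_scope.
Set Implicit Arguments.
Unset Strict Implicit.
Unset Printing Implicit Defensive.

(** * Families and the multinomial formula *)

Section FamilySums.
Variable I : choiceType.
Implicit Types (M : family I) (s : seq I).

(** Supports vary from family to family; this moves a product to one common enumeration, the extra
    indices contributing the neutral [f x 0]. *)
Lemma big_finsupp (R : Type) (idx : R) (op : Monoid.com_law idx)
    (f : I -> nat -> R) M s :
  uniq s -> {subset finsupp M <= s} -> (forall x, f x 0%N = idx) ->
  \big[op/idx]_(x <- finsupp M) f x (M x) = \big[op/idx]_(x <- s) f x (M x).
Proof.
move=> us Ms f0; rewrite [RHS](bigID (mem (finsupp M))) /= [X in op _ X]big1.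
  rewrite Monoid.mulm1 -[RHS]big_filter; apply: perm_big; apply: uniq_perm.
  - exact: fset_uniq.
  - exact: filter_uniq.
  by move=> x; rewrite mem_filter andb_idr // => /Ms.
by move=> x /fsfun_dflt ->.
Qed.

(** The weak compositions of [q] over [s], listed by the value at the head; sums over families thus
    become sums over a sequence. *)
Fixpoint families s (q : nat) : seq (family I) :=
  if s is x :: s' then
    [seq [fsfun M with x |-> a] | a <- iota 0 q.+1, M <- families s' (q - a)%N]
  else nseq (q == 0)%N [fsfun].

Lemma families_cons x s q : families (x :: s) q =
  [seq [fsfun M with x |-> a] | a <- iota 0 q.+1, M <- families s (q - a)%N].
Proof. by []. Qed.

Lemma finsupp_sub_cons x s M :
  {subset finsupp [fsfun M with x |-> 0%N] <= s} <->
  {subset finsupp M <= x :: s}.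
Proof.
rewrite finsupp_with eqxx; split=> H y.
  move=> yM; rewrite inE; case: eqVneq => //= yx; apply: H.
  by rewrite !inE yx.
by rewrite !inE => /andP[yx /H]; rewrite inE (negPf yx).
Qed.

Lemma fcard_cons x s M : uniq (x :: s) -> {subset finsupp M <= x :: s} ->
  fcard M = (M x + fcard [fsfun M with x |-> 0%N])%N.
Proof.
move=> /[dup] us /= /andP[xs us'] Ms.
rewrite /fcard (@big_finsupp _ _ _ (fun _ n => n) M (x :: s)) //.
rewrite (@big_finsupp _ _ _ (fun _ n => n) _ s) //; last exact/finsupp_sub_cons.
rewrite big_cons; congr addn; apply: eq_big_seq => y ys.
by rewrite fsfun_withE; case: eqP => // yx; rewrite -yx ys in xs.
Qed.

Lemma ffact_cons x s M : uniq (x :: s) -> {subset finsupp M <= x :: s} ->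
  ffact M = ((M x)`! * ffact [fsfun M with x |-> 0%N])%N.
Proof.
move=> /[dup] us /= /andP[xs us'] Ms.
rewrite /ffact (@big_finsupp _ _ _ (fun _ n => n`!) M (x :: s)) //.
rewrite (@big_finsupp _ _ _ (fun _ n => n`!) _ s) //; last exact/finsupp_sub_cons.
rewrite big_cons; congr muln; apply: eq_big_seq => y ys.
by rewrite fsfun_withE; case: eqP => // yx; rewrite -yx ys in xs.
Qed.

Lemma fsfun_with_with M x a b :
  [fsfun [fsfun M with x |-> a] with x |-> b] = [fsfun M with x |-> b].
Proof. by apply/fsfunP => y; rewrite !fsfun_withE; case: eqP. Qed.

Lemma families_dflt s q M x : M \in families s q -> x \notin s -> M x = 0%N.
Proof.
elim: s q M => [|y s IH] q M.
  by rewrite /=; case: (q == 0)%N; rewrite //= inE => /eqP->; rewrite fsfunE.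
rewrite families_cons => /allpairsPdep[a [M' [_ M's ->]]].
by rewrite inE negb_or fsfun_withE => /andP[/negPf-> /(IH _ _ M's)].
Qed.

Lemma mem_families s q M : uniq s ->
  reflect ({subset finsupp M <= s} /\ fcard M = q) (M \in families s q).
Proof.
elim: s q M => [|x s IH] q M us.
  apply: (iffP idP) => [/=|[M0 <-]].
    case: eqP => //= ->; rewrite inE => /eqP->.
    by rewrite /fcard finsupp0 big_nil; split => // y; rewrite in_finsupp0.
  have {}M0: M = [fsfun].
    apply/fsfunP => y; rewrite fsfunE fsfun_dflt //.
    by apply/negP => /M0.
  by rewrite M0 /fcard finsupp0 big_nil /= inE.
have /andP[xs us'] := us.
rewrite families_cons; apply: (iffP allpairsPdep) => [[a [M' [aq M's ->]]]|[Ms <-]].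
  have M'x := families_dflt M's xs.
  have M'0 : [fsfun M' with x |-> 0%N] = M' by rewrite -[in RHS](fsfun_with_id M' x) M'x.
  have [M'sub cM'] := IH _ _ us' M's.
  have sub : {subset finsupp [fsfun M' with x |-> a] <= x :: s}.
    by apply/finsupp_sub_cons; rewrite fsfun_with_with M'0.
  split=> //; rewrite (fcard_cons us sub) fsfun_with_with M'0 fsfun_with cM'.
  by rewrite subnKC //; move: aq; rewrite mem_iota.
exists (M x), [fsfun M with x |-> 0%N].
rewrite fsfun_with_with fsfun_with_id (fcard_cons us Ms); split=> //.
  by rewrite mem_iota /= add0n ltnS leq_addr.
by rewrite addKn; apply/IH => //; split=> //; apply/finsupp_sub_cons.
Qed.

Lemma families_uniq s q : uniq s -> uniq (families s q).
Proof.
elim: s q => [|x s IH] q; first by rewrite /=; case: (q == 0)%N.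
move=> /andP[xs us]; rewrite families_cons; apply: allpairs_uniq_dep => [|a _|].
- exact: iota_uniq.
- exact: IH.
move=> [a M] [b M'] /allpairsPdep[a' [M1 [_ M1s [-> ->]]]].
case/allpairsPdep => [b' [M2 [_ M2s [-> ->]]]] /= eqM.
have ab : a' = b' by have := congr1 (fun M : family I => M x) eqM; rewrite !fsfun_with.
rewrite ab; congr existT.
rewrite -[M1](fsfun_with_id _ x) -[M2](fsfun_with_id _ x).
rewrite (families_dflt M1s xs) (families_dflt M2s xs).
by rewrite -(fsfun_with_with M1 x a') eqM fsfun_with_with.
Qed.

(** Induction on [s]: the binomial formula isolates the power of the head, and the induction
    hypothesis expands the rest. *)
Lemma multinomial (R : comNzRingType) (z : I -> R) s q : uniq s ->
  (\sum_(x <- s) z x) ^+ q =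
  \sum_(M <- families s q) (q`! %/ ffact M)%:R * \prod_(x <- s) z x ^+ M x.
Proof.
elim: s q => [|x s IH] q us.
  rewrite big_nil expr0n /=; case: eqP => [->|_] /=; last by rewrite big_nil.
  by rewrite big_seq1 big_nil /ffact finsupp0 big_nil divn1 mulr1.
have /andP[xs us'] := us.
rewrite families_cons big_cons addrC exprDn big_allpairs_dep.
rewrite -[iota 0 q.+1]/(index_iota 0 q.+1) big_mkord; apply: eq_bigr => -[a /= aq] _.
rewrite IH // mulr_suml -sumrMnl big_seq [RHS]big_seq; apply: eq_bigr => M Ms.
have [Msub cM] := mem_families (q - a)%N M us' Ms.
have Mx := families_dflt Ms xs.
have M0 : [fsfun M with x |-> 0%N] = M by rewrite -[in RHS](fsfun_with_id M x) Mx.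
have sub : {subset finsupp [fsfun M with x |-> a] <= x :: s}.
  by apply/finsupp_sub_cons; rewrite fsfun_with_with M0.
rewrite (ffact_cons us sub) fsfun_with_with M0 fsfun_with big_cons fsfun_with.
have -> : \prod_(y <- s) z y ^+ [fsfun M with x |-> a] y = \prod_(y <- s) z y ^+ M y.
  apply: eq_big_seq => y ys; rewrite fsfun_withE; case: eqP => // yx.
  by rewrite -yx ys in xs.
(* The quotients of factorials are exact, so natural-number division behaves as rational
   division. *)
have /dvdnP[d dE] : (ffact M %| (q - a)`!)%N by rewrite -cM dvdn_ffact.
have F0 : (0 < ffact M)%N by rewrite prodn_gt0 // => y; rewrite fact_gt0.
have -> : (q`! %/ (a`! * ffact M) = 'C(q, a) * ((q - a)`! %/ ffact M))%N.
  rewrite -(@bin_fact q a) // dE mulnK // mulnA -mulnA [(a`! * _)%N]mulnCA.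
  by rewrite mulnA mulnK // muln_gt0 fact_gt0.
rewrite natrM; set A := \prod_(y <- s) _; set B := _%:R; set C := z x ^+ a.
by rewrite -!mulrA [C * A]mulrC mulr_natl.
Qed.
End FamilySums.

(** Classes outside the image of [s] have empty inner sums, so the possibly infinite index set [A]
    reduces to a finite one. *)
Lemma fsbig_fiber (V : nmodType) (I J : choiceType) (s : seq I) (h : I -> J)
    (A : set J) (F : I -> V) : (forall x, x \in s -> A (h x)) ->
  \sum_(a \in A) \sum_(x <- s | h x == a) F x = \sum_(x <- s) F x.
Proof.
move=> hA; rewrite (fsbigE (undup (map h s))) ?undup_uniq //; last first.
- move=> a _; rewrite mem_undup => /negP ha.
  rewrite big_seq_cond big1 // => x /andP[xs /eqP hx].
  by case: ha; rewrite -hx map_f.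
- by move=> a /=; rewrite mem_undup => /mapP[x xs ->]; apply: hA.
rewrite (exchange_big_dep xpredT) //= big_seq [RHS]big_seq.
apply: eq_bigr => x xs; rewrite (eq_bigl (pred1 (h x))) => [|a /=].
  by rewrite -big_filter filter_pred1_uniq ?undup_uniq ?mem_undup ?map_f // big_seq1.
rewrite eq_sym; case: eqP => [->|]; last by rewrite andbF.
by rewrite andbT; apply/asboolP/hA.
Qed.

(** * Linear combinations of families and their additive statistics *)

Section FamilyCombination.
Variables I J : choiceType.
Implicit Types (L : I -> family J) (N : family I).

Definition family_sum L N : family J :=
  [fsfun j in [fset j | j in flatten [seq enum_fset (finsupp (L x)) | x <- finsupp N]]%fset
     => (\sum_(x <- finsupp N) N x * L x j)%N].

Lemma family_sumE L N j :
  family_sum L N j = (\sum_(x <- finsupp N) N x * L x j)%N.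
Proof.
rewrite fsfunE; case: ifPn => // /negP jN; rewrite big_seq big1 // => x xN.
rewrite (@fsfun_dflt _ _ _ (L x)) ?muln0 //; apply/negP => jL; case: jN.
by rewrite inE; apply/flattenP; exists (enum_fset (finsupp (L x))) => //; apply: map_f.
Qed.

(** Any statistic turning addition of exponents into [op] distributes over [family_sum];
    cardinality, norm, grade and monomial are instances. *)
Lemma big_family_sum (R : Type) (idx : R) (op : Monoid.com_law idx)
    (f : J -> nat -> R) L N : (forall j, f j 0%N = idx) ->
  (forall j m n, f j (m + n)%N = op (f j m) (f j n)) ->
  \big[op/idx]_(j <- finsupp (family_sum L N)) f j (family_sum L N j) =
  \big[op/idx]_(x <- finsupp N) \big[op/idx]_(j <- finsupp (L x)) f j (N x * L x j)%N.
Proof.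
move=> f0 fD.
set s := undup (flatten [seq enum_fset (finsupp (L x)) | x <- finsupp N]).
have sE x j : x \in finsupp N -> j \in finsupp (L x) -> j \in s.
  move=> xN jL; rewrite mem_undup; apply/flattenP.
  by exists (enum_fset (finsupp (L x))) => //; apply: map_f.
rewrite (@big_finsupp _ _ _ _ _ _ s) ?undup_uniq //; last first.
  move=> j; rewrite mem_finsupp family_sumE => /eqP; apply: contra_notT => js.
  rewrite big_seq big1 // => x xN; rewrite (@fsfun_dflt _ _ _ (L x)) ?muln0 //.
  by apply: contra js; apply: sE.
have -> : \big[op/idx]_(x <- finsupp N) \big[op/idx]_(j <- finsupp (L x))
    f j (N x * L x j)%N =
  \big[op/idx]_(x <- finsupp N) \big[op/idx]_(j <- s) f j (N x * L x j)%N.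
  rewrite big_seq [RHS]big_seq; apply: eq_bigr => x xN.
  apply: (@big_finsupp _ _ _ _ (fun j n => f j (N x * n)%N)).
  - exact: undup_uniq.
  - by move=> j; apply: sE.
  - by move=> j; rewrite muln0.
rewrite exchange_big /=; apply: eq_bigr => j _; rewrite family_sumE.
by elim/big_rec2: _ => // x a b _ <-; rewrite fD.
Qed.
End FamilyCombination.

Definition fdelta (J : choiceType) (j : J) : family J := [fsfun [fsfun] with j |-> 1%N].

Lemma fdeltaE (J : choiceType) (j k : J) : fdelta j k = (k == j) :> nat.
Proof. by rewrite fsfun_withE fsfunE; case: eqP. Qed.

Lemma finsupp_fdelta (J : choiceType) (j : J) : finsupp (fdelta j) = [fset j]%fset.
Proof. by apply/fsetP => k; rewrite mem_finsupp fdeltaE in_fset1; case: (k == j). Qed.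

Section FamilyStat.
Variables (I J : choiceType) (L : I -> family J) (N : family I).

Lemma fcard_family_sum :
  fcard (family_sum L N) = (\sum_(x <- finsupp N) N x * fcard (L x))%N.
Proof.
rewrite /fcard (@big_family_sum _ _ _ _ _ (fun _ n => n)) //.
by apply: eq_bigr => x _; rewrite big_distrr.
Qed.

Lemma fgrade_family_sum r (deg : J -> zvec r) :
  fgrade deg (family_sum L N) = \sum_(x <- finsupp N) fgrade deg (L x) *+ N x.
Proof.
rewrite /fgrade (@big_family_sum _ _ _ _ _ (fun j n => deg j *+ n)) //.
  by apply: eq_bigr => x _; rewrite -sumrMnl; apply: eq_bigr => j _; rewrite mulnC mulrnA.
by move=> j m n; rewrite mulrnDr.
Qed.

Lemma fmono_family_sum (K : fieldType) (a : J -> K) :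
  fmono a (family_sum L N) = \prod_(x <- finsupp N) fmono a (L x) ^+ N x.
Proof.
rewrite /fmono (@big_family_sum _ _ _ _ _ (fun j n => a j ^+ n)) //.
  by apply: eq_bigr => x _; rewrite -prodrXl; apply: eq_bigr => j _; rewrite mulnC exprM.
by move=> j m n; rewrite exprD.
Qed.
End FamilyStat.

Lemma fcard_delta (J : choiceType) (j : J) : fcard (fdelta j) = 1%N.
Proof. by rewrite /fcard finsupp_fdelta big_seq_fset1 fdeltaE eqxx. Qed.

Lemma fgrade_delta (J : choiceType) r (deg : J -> zvec r) j :
  fgrade deg (fdelta j) = deg j.
Proof. by rewrite /fgrade finsupp_fdelta big_seq_fset1 fdeltaE eqxx. Qed.

Lemma fmono_delta (J : choiceType) (K : fieldType) (a : J -> K) j :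
  fmono a (fdelta j) = a j.
Proof. by rewrite /fmono finsupp_fdelta big_seq_fset1 fdeltaE eqxx. Qed.

Lemma fnorm_family_sum (I J : choiceType) (L : I -> family (J * nat)%type) (N : family I) :
  fnorm (family_sum L N) = (\sum_(x <- finsupp N) N x * fnorm (L x))%N.
Proof.
rewrite /fnorm (@big_family_sum _ _ _ _ _ (fun j n => j.2 * n)%N) //.
- by apply: eq_bigr => x _; rewrite big_distrr; apply: eq_bigr => j _; rewrite mulnCA.
- by move=> j; rewrite muln0.
by move=> j m n; rewrite mulnDr.
Qed.

Lemma fnorm_delta (J : choiceType) (j : J * nat) : fnorm (fdelta j) = j.2.
Proof. by rewrite /fnorm finsupp_fdelta big_seq_fset1 fdeltaE eqxx muln1. Qed.

(** * Collecting the families of indices *)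

Section Collect.
Variables (r : nat) (K : fieldType) (P : {poly mfps r K}) (y0 : mfps r K).
Variables (dy : nat) (k : 'X_{1..r}) (n : zvec r) (q : nat).
Hypothesis q0 : (0 < q)%N.
Implicit Types N : family (eindex r).

(** With [powC], the exponents [S] of the coefficients of [P] and [T] of those of [y0] in the
    product attached to [N]. *)
Definition powA N : family ('X_{1..r} * nat)%type :=
  family_sum (fun x => fdelta (ix_i x, ix_j x)) N.
Definition powC N : family 'X_{1..r} := family_sum (@ix_L r) N.

Definition admissible N := forall x, x \in finsupp N -> eindex_ok P y0 dy k x.

Lemma powA_eq N (S : family ('X_{1..r} * nat)%type) :
  (forall i j, (\sum_(x <- finsupp N | (ix_i x == i) && (ix_j x == j)) N x)%N
     = S (i, j)) <-> powA N = S.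
Proof.
have powAE i j : powA N (i, j) =
    (\sum_(x <- finsupp N | (ix_i x == i) && (ix_j x == j)) N x)%N.
  rewrite family_sumE [RHS]big_mkcond; apply: eq_bigr => x _.
  rewrite fdeltaE xpair_eqE eq_sym [j == _]eq_sym.
  by case: ifP => _; rewrite ?muln1 ?muln0.
split=> [NS|<- i j]; last by rewrite powAE.
by apply/fsfunP => -[i j]; rewrite powAE NS.
Qed.

Lemma powC_eq N (T : family 'X_{1..r}) :
  (forall i, (\sum_(x <- finsupp N) N x * ix_L x i)%N = T i) <-> powC N = T.
Proof.
split=> [NT|<- i]; last by rewrite family_sumE.
by apply/fsfunP => i; rewrite family_sumE NT.
Qed.

(** The exponent of [y] in the product attached to [N]. *)
Definition ydeg N : nat := (\sum_(x <- finsupp N) N x * ix_m x)%N.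

Lemma fcard_powA N : fcard (powA N) = fcard N.
Proof.
by rewrite fcard_family_sum; apply: eq_bigr => x _; rewrite fcard_delta muln1.
Qed.

Lemma fcard_powC N : admissible N -> (fcard (powC N) + ydeg N = fnorm (powA N))%N.
Proof.
move=> Nok; rewrite fcard_family_sum fnorm_family_sum -big_split big_seq [RHS]big_seq /=.
apply: eq_bigr => x /Nok[_ _ _ _ [/andP[mj _] _ -> _]].
by rewrite fnorm_delta -mulnDr subnK.
Qed.

Lemma fgrade_powC N : admissible N ->
  fgrade (@zv r) (powC N) =
  fgrade (@ix_l r) N + zv (ik P y0 k) *+ fcard N - zv (gsucc k) *+ ydeg N
  - fgrade (fun x => zv x.1) (powA N).
Proof.
move=> Nok; rewrite !fgrade_family_sum -[fgrade (@ix_l r) N]/(\sum_(x <- finsupp N) ix_l x *+ N x).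
rewrite -[fcard N]/(\sum_(x <- finsupp N) N x)%N /ydeg -!sumrMnr.
rewrite -big_split -!sumrB big_seq [RHS]big_seq /=.
apply: eq_bigr => x /Nok[_ _ _ _ [_ _ _ ->]].
by rewrite fgrade_delta /= !mulrnBl mulrnDl mulnC mulrnA.
Qed.

(** By the two preceding identities, the size and grade conditions on [S] and [T] become conditions
    on [N] alone: total exponent [n] in [u] and [q - 1] in [y]. *)
Lemma collect_index N : admissible N -> fcard N = q ->
  (Sindex r dy q (powA N) /\ Tindex P y0 k n q (powA N) (powC N)) <->
  (fgrade (@ix_l r) N = n /\ (ydeg N).+1 = q).
Proof.
move=> Nok cN; have cT := fcard_powC Nok; have gT := fgrade_powC Nok.
split=> [[_ [_ + +]]|[ln mq]].
  rewrite -cT -addnS => /addnI mq; rewrite gT cN mq /= => H; split=> //.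
  exact: (addIr _ (addIr _ (addIr _ H))).
split; split=> //.
- move=> x /=; rewrite mem_finsupp family_sumE => H.
  apply/negP => xdy; case/negP: H; apply/eqP; rewrite big_seq big1 // => y yN.
  rewrite fdeltaE; case: eqP => [xE|_]; last by rewrite muln0.
  have [_ _ _ _ [/andP[_ jdy] _ _ _]] := Nok _ yN.
  by move: xdy; rewrite xE /= jdy.
- by rewrite fcard_powA.
- by rewrite -mq -cT ltnS leq_addl.
- move=> i; rewrite mem_finsupp family_sumE => H.
  apply: contrapT => iS; case/negP: H; apply/eqP; rewrite big_seq big1 // => x xN.
  have [_ _ _ _ [_ up _ _]] := Nok _ xN.
  rewrite (@fsfun_dflt _ _ _ (ix_L x)) ?muln0 //.
  by apply/negP => /up /iS.
- by rewrite -mq addnS cT.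
- by rewrite gT ln cN -mq.
Qed.

(** The sum over [N] is split along the fibres of [powA], then of [powC]; the monomials are constant
    on each fibre, and the weights add up to [ecoef]. *)
Lemma collect_sum (sN : seq (family (eindex r))) : uniq sN ->
  (forall N, N \in sN <-> [/\ admissible N, fcard N = q,
     fgrade (@ix_l r) N = n & (ydeg N).+1 = q]) ->
  \sum_(S \in Sindex r dy q)
        fmono (fun x => P`_x.2 x.1) S *
        \sum_(T \in Tindex P y0 k n q S)
          (ecoef P y0 dy k q S T)%:R * fmono y0 T =
  \sum_(N <- sN) (eweight q N)%:R *
    \prod_(x <- finsupp N) (P`_(ix_j x) (ix_i x) * fmono y0 (ix_L x)) ^+ N x.
Proof.
move=> usN sNE.
pose F N : K := (eweight q N)%:R *
  (fmono (fun x => P`_x.2 x.1) (powA N) * fmono y0 (powC N)).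
transitivity (\sum_(N <- sN) F N); last first.
  apply: eq_bigr => N _; congr (_ * _); rewrite !fmono_family_sum -big_split /=.
  by apply: eq_bigr => x _; rewrite exprMn fmono_delta.
have sNST N : N \in sN ->
    Sindex r dy q (powA N) /\ Tindex P y0 k n q (powA N) (powC N).
  by case/sNE => Nok cN ln mq; apply/(collect_index Nok cN).
have ecoefE S T : Sindex r dy q S -> Tindex P y0 k n q S T ->
    ecoef P y0 dy k q S T =
    (\sum_(N <- sN | (powA N == S) && (powC N == T)) eweight q N)%N.
  move=> SI TI; rewrite /ecoef -[RHS]big_filter [RHS]fsbig_seq ?filter_uniq //.
  apply: eq_fsbigl; apply/seteqP; split=> N /=.
    move=> [Nok /powA_eq NS cN /powC_eq NT].
    rewrite mem_filter NS NT !eqxx /=; apply/sNE.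
    by have [|ln mq] := (collect_index Nok cN).1; [rewrite NS NT|split].
  rewrite mem_filter => /andP[/andP[/eqP NS /eqP NT] /sNE[Nok cN ln mq]].
  by split=> //; [apply/powA_eq|apply/powC_eq].
rewrite -(@fsbig_fiber _ _ _ sN powA (Sindex r dy q) F); last by move=> N /sNST[].
apply: eq_fsbigr => S; rewrite in_setE => SI.
transitivity (fmono (fun x => P`_x.2 x.1) S * \sum_(T \in Tindex P y0 k n q S)
  \sum_(N <- [seq N <- sN | powA N == S] | powC N == T) (eweight q N)%:R * fmono y0 T).
  congr (_ * _); apply: eq_fsbigr => T; rewrite in_setE => TI.
  by rewrite ecoefE // natr_sum mulr_suml big_filter_cond.
transitivity (fmono (fun x => P`_x.2 x.1) S *
  \sum_(N <- [seq N <- sN | powA N == S]) (eweight q N)%:R * fmono y0 (powC N)).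
  congr (_ * _); rewrite -[RHS](@fsbig_fiber _ _ _ _ powC (Tindex P y0 k n q S)).
    by apply: eq_fsbigr => T _; apply: eq_bigr => N /eqP->.
  by move=> N; rewrite mem_filter => /andP[/eqP<- /sNST[]].
rewrite mulr_sumr big_filter; apply: eq_bigr => N /eqP NS.
by rewrite /F NS mulrCA.
Qed.
End Collect.

(** * Additivity of the truncated logarithm *)

Section Logarithm.
Variable K : fieldType.
Hypothesis charK : [pchar K] =i pred0.

Lemma natf_neq0 n : (0 < n)%N -> n%:R != 0 :> K.
Proof. by move=> n0; move/pcharf0P: charK => ->; rewrite -lt0n. Qed.

(* The truncation of [- log (1 - z)]. *)
Definition logt (B : comNzRingType) (f : K -> B) M (z : B) : B :=
  \sum_(1 <= q < M.+1) f q%:R^-1 * z ^+ q.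

Local Notation bpoly := {poly {poly K}}.
Local Notation X := (polyX _).
Local Notation V := (polyC (polyX K)).
Local Notation W := (X + V - X * V).

Lemma bcoefM_neq0 (f g : bpoly) a b : (f * g)`_a`_b != 0 ->
  exists i j, [/\ (i <= a)%N, (j <= b)%N, f`_i`_j != 0 & g`_(a - i)`_(b - j) != 0].
Proof.
move=> fg; apply: contrapT => H; case/eqP: fg.
rewrite coefM coef_sum big1 // => i _; rewrite coefM big1 // => j _.
apply: contrapT => /eqP; rewrite mulf_eq0 negb_or => /andP[fn gn]; apply: H.
by exists i, j; rewrite -ltnS ltn_ord -ltnS ltn_ord.
Qed.

(** Each of the [q] factors contributes [x], [v] or [xv]. *)
Lemma coef_bsumX q a b : (W ^+ q)`_a`_b != 0 -> [/\ a <= q, b <= q & q <= a + b]%N.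
Proof.
elim: q a b => [|q IH] a b.
  rewrite expr0 coef1; case: a => [|a] /=; last by rewrite mulr0n coef0 eqxx.
  by rewrite coef1; case: b => //= b; rewrite eqxx.
rewrite exprS => /bcoefM_neq0[i [j [ia jb Wij /IH[]]]].
have : [/\ i <= 1, j <= 1 & 1 <= i + j]%N.
  have WE : W`_i = (i == 1)%:R + (if i == 0 then 'X else 0)
      - (if i == 0 then 0 else if i.-1 == 0 then 'X else 0).
    by rewrite coefB coefD coefX coefXM !coefC.
  move: Wij; rewrite {}WE.
  case: i {ia} => [|[|i]] /=; rewrite ?mulr0n ?mulr1n ?add0r ?addr0 ?subr0;
    rewrite ?coefB ?coefX ?coef1 ?coef0 ?eqxx //;
    by case: j {jb} => [|[|j]]; rewrite /= ?mulr0n ?subrr ?oppr0 ?coef0 ?eqxx.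
by move: ia jb; clear => ia jb [i1 j1 ij] ai bj qab; split; lia.
Qed.

Lemma logt0 (B : comNzRingType) (f : K -> B) M : logt f M 0 = 0.
Proof.
by rewrite /logt big_add1 big1 // => q _; rewrite expr0n mulr0.
Qed.

Local Notation bC := (polyC \o polyC).
Local Notation blog M Z := (logt bC M Z).

(** The derivative is [Z'] times the geometric sum of [Z^q] for [q < M]; characteristic zero cancels
    the factors [1/q]. *)
Lemma deriv_blog M Z : (1 - Z) * (blog M Z)^`() = (1 - Z ^+ M) * Z^`().
Proof.
rewrite /logt raddf_sum big_add1 /= big_mkord.
rewrite -[1 - Z ^+ M]opprB subrX1 -mulNr opprB -mulrA big_distrl /=.
congr (_ * _); apply: eq_bigr => q _.
rewrite derivM derivC mul0r add0r deriv_exp /= mulrnAr -mulrnAl.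
have -> : (q.+1%:R^-1)%:P%:P *+ q.+1 = 1 :> bpoly.
  by rewrite -!rmorphMn /= -mulr_natr mulVf ?natf_neq0 // !polyC1.
by rewrite mul1r mulrC.
Qed.

Lemma coef_blog_neq0 M Z a b : (blog M Z)`_a`_b != 0 ->
  exists q, [/\ (0 < q)%N, (q <= M)%N & (Z ^+ q)`_a`_b != 0].
Proof.
move=> H; apply: contrapT => nq; case/eqP: H.
rewrite /logt !coef_sum big_add1 big_mkord big1 // => q _.
rewrite !coefCM; apply: contrapT => /eqP; rewrite mulf_eq0 negb_or => /andP[_ Zq].
by apply: nq; exists q.+1; rewrite ltn_ord.
Qed.

(* [(1 - x) (1 - v) = 1 - (x + v - x v)], so the untruncated defect would be zero; here the
   derivative in [x] of the defect, times [1 - x], is [x^M - (x + v - x v)^M]. *)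
Lemma logtD_vanish M a b : (a + b <= M)%N ->
  (blog M W - blog M X - blog M V)`_a`_b = 0.
Proof.
set H := (_ - _ - _).
have V1 : 1 - V != 0.
  by rewrite -polyC1 -polyCB polyC_eq0 -opprB oppr_eq0 polyXsubC_eq0.
have dH : (1 - X) * H^`() = X ^+ M - W ^+ M.
  have dV : (blog M V)^`() = 0.
    by apply: (mulfI V1); apply: etrans (deriv_blog M V) _; rewrite derivC !mulr0.
  have dW : W^`() = 1 - V.
    by rewrite derivB derivD derivM !derivC derivX mulr0 mul1r !addr0.
  have eW := deriv_blog M W; rewrite dW in eW.
  have eX := deriv_blog M X; rewrite derivX mulr1 in eX.
  apply: (mulIf V1); rewrite /H !derivB dV subr0.
  have -> : X ^+ M - W ^+ M = (1 - W ^+ M) - (1 - X ^+ M) by ring.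
  rewrite [RHS]mulrBl -eW -eX.
  ring.
(* At [x = 0] the element [x + v - xv] becomes [v], so the two remaining logarithms cancel. *)
have H0 : H`_0 = 0.
  have hlog Z : (blog M Z).[0] = logt polyC M Z.[0].
    by rewrite /logt horner_sum; apply: eq_bigr => q _; rewrite hornerM hornerC horner_exp.
  have W0 : W.[0] = 'X.
    by rewrite !(hornerD, hornerN, hornerM, hornerX, hornerC) mul0r oppr0 addr0 add0r.
  by rewrite -horner_coef0 /H !(hornerD, hornerN) !hlog W0 hornerX hornerC logt0 subr0 subrr.
(* The equation for [H'] is a recursion on the power of [x] whose source term has no monomial of
   total degree below [M]. *)
have dH0 i j : (i + j < M)%N -> H^`()`_i`_j = 0.
  have E l : H^`()`_l = (X ^+ M - W ^+ M)`_l + (X * H^`())`_l.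
    by rewrite -dH -coefD mulrBl mul1r subrK.
  have E0 l : (l + j < M)%N -> (X ^+ M - W ^+ M)`_l`_j = 0.
    move=> lj; rewrite coefB coefXn; have -> : (l == M) = false by lia.
    rewrite mulr0n sub0r coefN; apply/eqP; rewrite oppr_eq0.
    by apply: contraLR lj => /coef_bsumX[_ _]; rewrite -leqNgt.
  elim: i => [|i IH] ij; rewrite E coefXM coefD E0 //= ?coef0 ?addr0 // add0r.
  exact: IH (ltnW ij).
case: a => [|a] abM; first by rewrite H0 coef0.
(* Integration in [x]: the factor [a + 1] is invertible in characteristic zero. *)
have := dH0 a b abM; rewrite coef_deriv coefMn -mulr_natr => /eqP.
by rewrite mulf_eq0 (negPf (natf_neq0 _)) // orbF => /eqP.
Qed.

(** The defect is computed once in the polynomial ring and then specialised, so the coefficients [c]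
    do not depend on [B], [x] or [v]. *)
Lemma logtD M : exists c : nat -> nat -> K,
  (forall a b, (a + b <= M)%N -> c a b = 0) /\
  forall (B : comNzRingType) (f : {rmorphism K -> B}) (x v : B),
  logt f M (x + v - x * v) = logt f M x + logt f M v +
    \sum_(a < M.+1) \sum_(b < M.+1) f (c a b) * x ^+ a * v ^+ b.
Proof.
set H := (blog M W - blog M X - blog M V).
exists (fun a b => H`_a`_b); split=> [a b|B f x v]; first exact: logtD_vanish.
pose g : {rmorphism {poly K} -> B} := horner_eval v \o map_poly f.
pose h : {rmorphism {poly {poly K}} -> B} := horner_eval x \o map_poly g.
have hC c : h (c%:P%:P) = f c.
  by rewrite /h /= map_polyC /horner_eval hornerC /g /= map_polyC /horner_eval hornerC.
have hX : h X = x by rewrite /h /= map_polyX /horner_eval hornerX.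
have hV : h V = v.
  by rewrite /h /= map_polyC /horner_eval hornerC /g /= map_polyX /horner_eval hornerX.
have hlog z : h (blog M z) = logt f M (h z).
  by rewrite /logt rmorph_sum; apply: eq_bigr => q _; rewrite rmorphM hC rmorphXn.
(* The defect has degree at most [M] in each variable, which makes the double sum up to [M]
   complete. *)
have Hsize a b : H`_a`_b != 0 -> (a <= M)%N /\ (b <= M)%N.
  move=> Hab; suff [q [qM [Z ZW Zab]]] : exists q, (q <= M)%N /\
      exists2 Z, Z \in [:: W; X; V] & (Z ^+ q)`_a`_b != 0.
    have [aq bq] : (a <= q)%N /\ (b <= q)%N.
      move: ZW Zab; rewrite !inE => /or3P[] /eqP->.
      - by case/coef_bsumX.
      - rewrite coefXn; case: (a =P q) => [->|_]; last by rewrite mulr0n coef0 eqxx.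
        by rewrite mulr1n coef1; case: b {Hab} => [|b]; rewrite ?mulr0n ?eqxx.
      - rewrite -polyC_exp coefC; case: (a =P 0%N) => [->|_]; last by rewrite coef0 eqxx.
        by rewrite coefXn; case: (b =P q) => [->|_]; rewrite ?mulr0n ?eqxx.
    by rewrite !(leq_trans _ qM).
  apply: contrapT => nq; case/eqP: Hab; rewrite /H !coefB.
  have z Z : Z \in [:: W; X; V] -> (blog M Z)`_a`_b = 0.
    move=> ZW; apply: contrapT => /eqP/coef_blog_neq0[q [_ qM Zab]].
    by apply: nq; exists q; split=> //; exists Z.
  by rewrite !z ?subrr // !inE eqxx ?orbT.
have hH : h H = \sum_(a < M.+1) \sum_(b < M.+1) f (H`_a`_b) * x ^+ a * v ^+ b.
  rewrite -[h H]/((map_poly g H).[x]) (@horner_coef_wide _ M.+1); last first.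
    apply/leq_sizeP => a aM; rewrite coef_map; have -> : H`_a = 0; last exact: rmorph0.
    apply/polyP => b; rewrite coef0; apply: contrapT => /eqP/Hsize[aM' _].
    by move: aM; rewrite ltnNge aM'.
  apply: eq_bigr => a _.
  transitivity ((map_poly f H`_a).[v] * x ^+ a); first by rewrite coef_map.
  rewrite (@horner_coef_wide _ M.+1).
    rewrite mulr_suml; apply: eq_bigr => b _; rewrite coef_map /=.
    by rewrite mulrAC.
  apply/leq_sizeP => b bM; rewrite coef_map.
  apply: contrapT => /eqP; rewrite fmorph_eq0 => /Hsize[_ bM'].
  by move: bM; rewrite ltnNge bM'.
rewrite -hH /H !rmorphB !hlog rmorphB rmorphD rmorphM hX hV.
by ring.
Qed.
End Logarithm.

(** * Coefficients and weights of power series *)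

Section SeriesCoefficients.
Variables (r : nat) (K : fieldType).
Local Notation fps := (mfps r K).
Local Notation mon := 'X_{1..r}.
Implicit Types (s t : fps) (m e : mon).

Lemma mfpsDE s t m : (s + t) m = s m + t m. Proof. by []. Qed.
Lemma mfpsNE s m : (- s) m = - s m. Proof. by []. Qed.
Lemma mfps0E m : (0 : fps) m = 0. Proof. by []. Qed.
Lemma mfps_sumE (I : Type) (l : seq I) (p : pred I) (F : I -> fps) m :
  (\sum_(i <- l | p i) F i) m = \sum_(i <- l | p i) F i m.
Proof. by apply: (big_morph (fun s : fps => s m)). Qed.
Lemma mfpsMnE s n m : (s *+ n) m = s m *+ n.
Proof. by elim: n => [|n IH]; rewrite ?mulr0n // !mulrS mfpsDE IH. Qed.

Lemma mfpsM_neq0 s t m : (s * t) m != 0 ->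
  exists a b, [/\ m = (a + b)%MM, s a != 0 & t b != 0].
Proof.
move=> st; apply: contrapT => H; case/eqP: st => /=; rewrite big1 // => -[a b] /= /eqP mab.
apply: contrapT => /eqP; rewrite mulf_eq0 negb_or => /andP[sa tb].
by apply: H; exists a, b.
Qed.

Lemma mfpsM_only s t m a b : m = (a + b)%MM ->
  (forall a' b', m = (a' + b')%MM -> s a' != 0 -> t b' != 0 -> a' = a) ->
  (s * t) m = s a * t b.
Proof.
move=> mab only /=.
have lt1 : (mdeg a < (mdeg m).+1)%N by rewrite mab mdegD ltnS leq_addr.
have lt2 : (mdeg b < (mdeg m).+1)%N by rewrite mab mdegD ltnS leq_addl.
rewrite (bigD1 (BMultinom lt1, BMultinom lt2)) /=; last by rewrite mab.
rewrite big1 ?addr0 // => -[a' b'] /= /andP[/eqP mab' ne].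
apply: contrapT => /eqP; rewrite mulf_eq0 negb_or => /andP[sa tb].
have aa := only _ _ mab' sa tb.
have bb : bmnm b' = b by apply: (@addmI _ a); apply: etrans mab; rewrite -aa.
by case/negP: ne; rewrite xpair_eqE -!val_eqE /= aa bb !eqxx.
Qed.

Lemma mfps_monoE e s m : (mfps_mono K e * s) m = if (e <= m)%MM then s (m - e)%MM else 0.
Proof.
case: ifP => em; last first.
  apply: contrapT => /eqP/mfpsM_neq0[a [b [mab]]] /=.
  case: (a =P e) => [ae _ _|_]; last by rewrite eqxx.
  by move: em; rewrite mab -ae lem_addr.
rewrite (@mfpsM_only _ _ _ e (m - e)%MM) /= ?eqxx ?mul1r //.
  by rewrite addmC submK.
by move=> a b _; case: (a =P e) => [->|_]; rewrite ?eqxx.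
Qed.

Lemma mfps_mono_add e s m : (mfps_mono K e * s) (e + m)%MM = s m.
Proof. by rewrite mfps_monoE lem_addr // addmC addmK. Qed.

Lemma mfps_monoM e e' : mfps_mono K e * mfps_mono K e' = mfps_mono K (e + e')%MM.
Proof.
apply/mfpsP => m; rewrite mfps_monoE /=; case: ifP => em.
  by congr (nat_of_bool _)%:R; apply/eqP/eqP => [<-|->]; rewrite addmC ?submK // addmK.
by case: eqP => // mE; move: em; rewrite mE lem_addr.
Qed.

Lemma mfps_mono0 : mfps_mono K 0%MM = 1 :> fps.
Proof. by apply/mfpsP => m /=; rewrite mulrb; case: eqP. Qed.

Lemma mfps_monoX e n : mfps_mono K e ^+ n = mfps_mono K (e *+ n)%MM.
Proof. by elim: n => [|n IH]; rewrite ?mulm0n ?mfps_mono0 // exprS IH mfps_monoM mulmS. Qed.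

Lemma mfps_constE c s m : (mfps_const r c * s) m = c * s m.
Proof.
rewrite (@mfpsM_only _ _ _ 0%MM m) ?add0m //= ?eqxx //.
by move=> a b _; case: (a =P 0%MM) => // _; rewrite eqxx.
Qed.

Lemma mfps_const_is_additive : zmod_morphism (@mfps_const r K).
Proof. by move=> a b; apply/mfpsP => m /=; rewrite mulrnBl. Qed.
Lemma mfps_const_is_multiplicative : GRing.monoid_morphism (@mfps_const r K).
Proof.
split=> // a b; apply/mfpsP => m; rewrite mfps_constE /= -mulrnAr //.
Qed.
HB.instance Definition _ :=
  GRing.isZmodMorphism.Build K fps (@mfps_const r K) mfps_const_is_additive.
HB.instance Definition _ :=
  GRing.isMonoidMorphism.Build K fps (@mfps_const r K) mfps_const_is_multiplicative.

(** Addition is strictly monotone for the graded order, so only the pair of least exponents can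
    reach [a + b]. *)
Lemma mfpsM_lead s t a b : (forall m, s m != 0 -> (a <= m)%O) ->
  (forall m, t m != 0 -> (b <= m)%O) -> (s * t) (a + b)%MM = s a * t b.
Proof.
move=> sa tb; apply: mfpsM_only => // a' b' mab /sa aa' /tb bb'.
apply/eqP; rewrite eq_le aa' andbT leNgt; apply/negP => lt.
by have := ltmc_le_add lt bb'; rewrite -mab ltxx.
Qed.

End SeriesCoefficients.

Section Weight.
Variables (r : nat) (K : fieldType).
Local Notation fps := (mfps r K).
Local Notation mon := 'X_{1..r}.
Variables (lam : mon -> nat) (wy : nat).
Hypothesis lamD : forall a b, lam (a + b)%MM = (lam a + lam b)%N.
Implicit Types U V : {poly fps}.

(* The weight of [u^f y^i] is [lam f + i wy]. *)
Definition wge c U := forall i f, U`_i f != 0 -> (c <= lam f + i * wy)%N.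

Lemma wgeW c d U : (c <= d)%N -> wge d U -> wge c U.
Proof. by move=> cd H i f /H; apply: leq_trans. Qed.
Lemma wge0 c : wge c 0. Proof. by move=> i f; rewrite coef0 eqxx. Qed.
Lemma wgeD c U V : wge c U -> wge c V -> wge c (U + V).
Proof.
move=> HU HV i f; rewrite coefD mfpsDE.
by have [->|/HU//] := eqVneq (U`_i f) 0; rewrite add0r => /HV.
Qed.
Lemma wgeN c U : wge c U -> wge c (- U).
Proof. by move=> HU i f; rewrite coefN mfpsNE oppr_eq0 => /HU. Qed.
Lemma wgeB c U V : wge c U -> wge c V -> wge c (U - V).
Proof. by move=> HU HV; apply/wgeD/wgeN. Qed.
Lemma wge_sum c (I : Type) (l : seq I) (p : pred I) (F : I -> {poly fps}) :
  (forall i, p i -> wge c (F i)) -> wge c (\sum_(i <- l | p i) F i).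
Proof. by move=> H; elim/big_rec: _ => [|i U pi]; [apply: wge0|apply/wgeD/H]. Qed.

Lemma polyfpsM_neq0 U V i f : (U * V)`_i f != 0 ->
  exists i1 i2 f1 f2, [/\ i = (i1 + i2)%N, f = (f1 + f2)%MM, U`_i1 f1 != 0 & V`_i2 f2 != 0].
Proof.
move=> UV; apply: contrapT => H; case/eqP: UV; rewrite coefM mfps_sumE big1 // => j _.
apply: contrapT => /eqP/mfpsM_neq0[f1 [f2 [fE Uj Vj]]]; apply: H.
by exists j, (i - j)%N, f1, f2; split=> //; rewrite subnKC // -ltnS.
Qed.

Lemma wgeM c d U V : wge c U -> wge d V -> wge (c + d) (U * V).
Proof.
move=> HU HV i f /polyfpsM_neq0[i1 [i2 [f1 [f2 [-> -> /HU h1 /HV h2]]]]].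
by rewrite lamD mulnDl addnACA leq_add.
Qed.
Lemma wgeX c U n : wge c U -> wge (n * c) (U ^+ n).
Proof. by move=> HU; elim: n => [|n IH] //; rewrite exprS mulSn; apply: wgeM. Qed.
Lemma wgeC c (s : fps) : (forall f, s f != 0 -> (c <= lam f)%N) -> wge c s%:P.
Proof.
move=> H i f; rewrite coefC; case: (i =P 0%N) => [->|_]; last by rewrite eqxx.
by rewrite mul0n addn0 => /H.
Qed.
Lemma wge_polyX : wge wy 'X.
Proof.
move=> i f; rewrite coefX; case: (i =P 1%N) => [->|_]; last by rewrite eqxx.
by rewrite mul1n leq_addl.
Qed.
Lemma wge_mulXn c U n : wge (c + n * wy) (U * 'X^n) -> wge c U.
Proof.
move=> H i f Ui; have := H (i + n)%N f; rewrite coefMXn.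
by rewrite ltnNge leq_addl addnK => /(_ Ui); lia.
Qed.
End Weight.

Section Symbol.
Variables (r : nat) (K : fieldType).
Local Notation fps := (mfps r K).
Local Notation mon := 'X_{1..r}.
Implicit Types (U V : {poly fps}) (a b : mon).

Definition pge a U := forall i f, U`_i f != 0 -> (a <= f)%O.
(** The coefficient of [u^a] as a polynomial in [y]; under [pge a U], when nonzero, it is the
    initial form of [U]. *)
Definition symb a U : {poly K} := \poly_(j < size U) (U`_j) a.

Lemma coef_symb a U j : (symb a U)`_j = U`_j a.
Proof.
rewrite coef_poly; case: ltnP => // Uj.
by rewrite (nth_default _ Uj).
Qed.

Lemma pgeM a b U V : pge a U -> pge b V -> pge (a + b)%MM (U * V).
Proof.
move=> HU HV i f /polyfpsM_neq0[i1 [i2 [f1 [f2 [_ -> /HU h1 /HV h2]]]]].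
exact: lem_add.
Qed.

Lemma symbM a b U V : pge a U -> pge b V -> symb (a + b)%MM (U * V) = symb a U * symb b V.
Proof.
move=> HU HV; apply/polyP => i; rewrite coef_symb !coefM mfps_sumE.
by apply: eq_bigr => j _; rewrite !coef_symb; apply: mfpsM_lead => m; [apply: HU|apply: HV].
Qed.

Lemma pge1 : pge 0%MM 1. Proof. by move=> i f _; apply: le0m. Qed.
Lemma symb1 : symb 0%MM 1 = 1.
Proof.
by apply/polyP => -[|i]; rewrite coef_symb !coef1 ?mulr0n //= eqxx.
Qed.

Lemma pgeX a U n : pge a U -> pge (a *+ n)%MM (U ^+ n).
Proof.
by move=> HU; elim: n => [|n IH]; [exact: pge1|rewrite exprS mulmS; apply: pgeM].
Qed.
Lemma symbX a U n : pge a U -> symb (a *+ n)%MM (U ^+ n) = symb a U ^+ n.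
Proof.
move=> HU; elim: n => [|n IH]; first exact: symb1.
by rewrite !exprS mulmS symbM ?IH //; apply: pgeX.
Qed.
Lemma pge0 a : pge a 0. Proof. by move=> i f; rewrite coef0 eqxx. Qed.
Lemma pgeD a U V : pge a U -> pge a V -> pge a (U + V).
Proof.
move=> HU HV i f; rewrite coefD mfpsDE.
by have [->|/HU//] := eqVneq (U`_i f) 0; rewrite add0r => /HV.
Qed.
Lemma pge_sum a (I : Type) (l : seq I) (p : pred I) (F : I -> {poly fps}) :
  (forall i, p i -> pge a (F i)) -> pge a (\sum_(i <- l | p i) F i).
Proof. by move=> H; elim/big_rec: _ => [|i U pi]; [apply: pge0|apply/pgeD/H]. Qed.
Lemma symb_sum a (I : Type) (l : seq I) (p : pred I) (F : I -> {poly fps}) :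
  symb a (\sum_(i <- l | p i) F i) = \sum_(i <- l | p i) symb a (F i).
Proof.
apply/polyP => j; rewrite coef_symb !coef_sum mfps_sumE.
by apply: eq_bigr => i _; rewrite coef_symb.
Qed.
Lemma pgeW a b U : (a <= b)%O -> pge b U -> pge a U.
Proof. by move=> ab H i f /H; apply: le_trans. Qed.
Lemma symb_gt a b U : (a < b)%O -> pge b U -> symb a U = 0.
Proof.
move=> ab H; apply/polyP => j; rewrite coef_symb coef0; apply: contrapT => /eqP/H.
by rewrite leNgt ab.
Qed.
End Symbol.

(** * Lagrange inversion *)

(** Clears denominators: multiplying the [q]-th power of a quotient by [z^M] leaves a polynomial
    expression as long as [q <= M]. *)
Lemma expr_homog (F : fieldType) (z w : F) q M : (q <= M)%N -> z != 0 ->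
  z ^+ (M - q) * w ^+ q = z ^+ M * (w / z) ^+ q.
Proof.
move=> qM z0; rewrite -{2}(subnK qM) exprD -mulrA; congr (_ * _).
by rewrite -exprMn mulrC divfK.
Qed.

Lemma homog_factor (F : fieldType) (t y D V : F) : y != 0 -> D != 0 ->
  (t * D + y * V - t * V) / (y * D) = t / y + V / D - t / y * (V / D).
Proof. by move=> y0 D0; field; rewrite y0 D0. Qed.

Lemma weightMn r (lam : 'X_{1..r} -> nat) m n :
  (forall a b, lam (a + b)%MM = (lam a + lam b)%N) -> lam (m *+ n)%MM = (lam m * n)%N.
Proof.
move=> lamD; elim: n => [|n IH]; last by rewrite mulmS lamD IH mulnS.
by rewrite mulm0n muln0; have := lamD 0%MM 0%MM; rewrite addm0; lia.
Qed.

Section Lagrange.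
Variable K : fieldType.
Hypothesis charK : [pchar K] =i pred0.

(* [logtD] at [x = t / y] and [v = V / D], multiplied by [(y D)^M]. *)
Lemma logtD_homog M : exists c : nat -> nat -> K,
  (forall a b, (a + b <= M)%N -> c a b = 0) /\
  forall (A : idomainType) (f : {rmorphism K -> A}) (t y D V : A), y != 0 -> D != 0 ->
  \sum_(1 <= q < M.+1) f q%:R^-1 * ((y * D) ^+ (M - q) * (t * D + y * V - t * V) ^+ q) =
  \sum_(1 <= q < M.+1) f q%:R^-1 * (D ^+ M * (y ^+ (M - q) * t ^+ q)) +
  \sum_(1 <= q < M.+1) f q%:R^-1 * (y ^+ M * (D ^+ (M - q) * V ^+ q)) +
  \sum_(a < M.+1) \sum_(b < M.+1)
     f (c a b) * ((y ^+ (M - a) * t ^+ a) * (D ^+ (M - b) * V ^+ b)).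
Proof.
have [c [c0 cE]] := logtD charK M; exists c; split=> // A f t y D V y0 D0.
(* The quotients [t / y] and [V / D] exist in the fraction field, into which the domain embeds. *)
apply/eqP; rewrite -tofrac_eq; apply/eqP.
have gy : tofrac y != 0 by rewrite tofrac_eq0.
have gD : tofrac D != 0 by rewrite tofrac_eq0.
have := cE _ (@tofrac A \o f) (tofrac t / tofrac y) (tofrac V / tofrac D).
move/(congr1 (fun z => (tofrac y * tofrac D) ^+ M * z)).
rewrite !mulrDr /logt !mulr_sumr => E.
rewrite !rmorphD !rmorph_sum; move: E.
have e1 q : (1 <= q < M.+1)%N -> 
    tofrac (f q%:R^-1 * ((y * D) ^+ (M - q) * (t * D + y * V - t * V) ^+ q)) =
  (tofrac y * tofrac D) ^+ M * ((@tofrac A \o f) q%:R^-1 *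
    (tofrac t / tofrac y + tofrac V / tofrac D - tofrac t / tofrac y * (tofrac V / tofrac D)) ^+ q).
  move=> /andP[_ qM]; rewrite !(rmorphM, rmorphXn, rmorphB, rmorphD).
  rewrite expr_homog ?mulf_neq0 // mulrCA.
  by rewrite homog_factor.
have e2 q : (1 <= q < M.+1)%N -> tofrac (f q%:R^-1 * (D ^+ M * (y ^+ (M - q) * t ^+ q))) =
  (tofrac y * tofrac D) ^+ M * ((@tofrac A \o f) q%:R^-1 * (tofrac t / tofrac y) ^+ q).
  move=> /andP[_ qM]; rewrite !(rmorphM, rmorphXn) expr_homog // [RHS]mulrCA.
  by rewrite [(_ * tofrac D) ^+ M]exprMn; congr (_ * _); rewrite mulrCA mulrA.
have e3 q : (1 <= q < M.+1)%N -> tofrac (f q%:R^-1 * (y ^+ M * (D ^+ (M - q) * V ^+ q))) =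
  (tofrac y * tofrac D) ^+ M * ((@tofrac A \o f) q%:R^-1 * (tofrac V / tofrac D) ^+ q).
  move=> /andP[_ qM]; rewrite !(rmorphM, rmorphXn) expr_homog // [RHS]mulrCA.
  by rewrite [(_ * tofrac D) ^+ M]exprMn; congr (_ * _); rewrite mulrA.
rewrite (eq_big_nat _ _ e1) (eq_big_nat _ _ e2) (eq_big_nat _ _ e3) => ->; congr (_ + _).
apply: eq_bigr => a _; rewrite mulr_sumr rmorph_sum; apply: eq_bigr => b _ /=.
have aM : (a <= M)%N by rewrite -ltnS.
have bM : (b <= M)%N by rewrite -ltnS.
rewrite !(rmorphM, rmorphXn) (expr_homog _ aM gy) (expr_homog _ bM gD).
by rewrite [(_ * tofrac D) ^+ M]exprMn [X in _ = _ * X]mulrACA [RHS]mulrCA !mulrA.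
Qed.

Variables (r : nat).
Local Notation fps := (mfps r K).
Local Notation mon := 'X_{1..r}.
Variables (lam : mon -> nat) (e N : mon) (om : K) (t : fps) (R : {poly fps}).
Hypothesis lamD : forall a b, lam (a + b)%MM = (lam a + lam b)%N.
Hypothesis om0 : om != 0.
Hypothesis Rt : root R t.
Let lamMn m n : lam (m *+ n)%MM = (lam m * n)%N.
Proof. exact: weightMn. Qed.

Local Notation D := (mfps_const r om * mfps_mono K e).
Local Notation Q := (D%:P * 'X - R).
Hypothesis t_ge : forall f, t f != 0 -> (lam N < lam f)%N.
Hypothesis Q_ge : wge lam (lam N) (lam e + lam N).+1 Q.

Lemma D_neq0 : D != 0.
Proof.
apply/eqP => /(congr1 (fun s : fps => s e)); rewrite mfps_constE /= eqxx mulr1.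
exact/eqP.
Qed.

Lemma mfps_powD n s m : (D ^+ n * s) (e *+ n + m)%MM = om ^+ n * s m.
Proof. by rewrite exprMn -rmorphXn mfps_monoX -mulrA mfps_constE mfps_mono_add. Qed.

(* [V] is the difference quotient [(Q(y) - Q(t)) / (y - t)]. *)
Lemma quotient_ge : exists2 V, Q = t%:P * D%:P + 'X * V - t%:P * V &
  wge lam (lam N) (lam e).+1 V.
Proof.
(* [Vm m] is [(y^m - t^m) / (y - t)]. *)
pose Vm m : {poly fps} := \sum_(i < m) 'X^(m.-1 - i) * t%:P ^+ i.
pose V := \sum_(m < size Q) Q`_m *: Vm m; exists V.
  have Qt : Q.[t] = D * t by rewrite !hornerE (eqP Rt) subr0.
  have QQt : Q - (D * t)%:P = ('X - t%:P) * V.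
    rewrite -Qt horner_coef rmorph_sum -{1}[Q]coefK poly_def /= -sumrB mulr_sumr.
    apply: eq_bigr => m _; rewrite -scalerAr -subrXX scalerBr -polyC_exp.
    by rewrite -[_ *: (_ ^+ _)%:P]mul_polyC -polyCM.
  by rewrite -[LHS](subrK (D * t)%:P) {}QQt (polyCM D); move: (D%:P) (t%:P) V => d s v; ring.
apply: wge_sum => m _; rewrite /Vm scaler_sumr; apply: wge_sum => i _.
(* Multiplication by [y^(i+1)] restores the monomial [Q_m y^m] times [t^i], whose weight is
   controlled by [Q_ge] and [t_ge]. *)
apply: (@wge_mulXn _ _ _ _ _ _ i.+1).
have -> : Q`_m *: ('X^(m.-1 - i) * t%:P ^+ i) * 'X^(i.+1) = (Q`_m *: 'X^m) * t%:P ^+ i.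
  rewrite -!scalerAl mulrAC -exprD; congr (_ *: ('X^ _ * _)).
  by have := ltn_ord i; lia.
apply: (@wgeW _ _ _ _ _ ((lam e + lam N).+1 + i * (lam N).+1)); first by lia.
apply: wgeM => //; last by apply: wgeX => //; apply: wgeC.
move=> l f; rewrite coefZ coefXn; case: (l =P m) => [->|_].
  by rewrite mulr1 => /Q_ge.
by rewrite mulr0 eqxx.
Qed.

(** Compares the coefficients of [y^(M-1) u^(M e + p)] in [logtD_homog], taken with [y] the
    variable. The bound on [lam p] makes [M] large enough for the truncation error to miss this
    monomial. *)
Lemma lagrange_inversion M p : (0 < M)%N -> (lam p <= M + lam N)%N ->
  t p = \sum_(1 <= q < M.+1) q%:R^-1 * om^-1 ^+ q * (Q ^+ q)`_q.-1 (e *+ q + p)%MM.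
Proof.
move=> M0 pM; have [V QE V_ge] := quotient_ge.
have [c [c0 cE]] := logtD_homog M.
have X0 : ('X : {poly fps}) != 0 by rewrite polyX_eq0.
have D0 : D%:P != 0 :> {poly fps} by rewrite polyC_eq0 D_neq0.
have := cE _ (polyC \o @mfps_const r K) t%:P 'X D%:P V X0 D0.
rewrite -QE => /(congr1 (fun U : {poly fps} => U`_M.-1 (e *+ M + p)%MM)).
rewrite !coefD !mfpsDE.
have -> : (\sum_(1 <= q < M.+1) (polyC \o @mfps_const r K) q%:R^-1 *
    (('X * D%:P) ^+ (M - q) * Q ^+ q))`_M.-1 (e *+ M + p)%MM =
  om ^+ M * \sum_(1 <= q < M.+1) q%:R^-1 * om^-1 ^+ q * (Q ^+ q)`_q.-1 (e *+ q + p)%MM.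
  rewrite coef_sum mfps_sumE mulr_sumr; apply: eq_big_nat => q /andP[q0 qM].
  rewrite /= coefCM mfps_constE exprMn -[_ * Q ^+ q]mulrA coefXnM.
  have -> : (M.-1 < M - q)%N = false by lia.
  have -> : (M.-1 - (M - q) = q.-1)%N by lia.
  rewrite -polyC_exp coefCM.
  have -> : (e *+ M + p = e *+ (M - q) + (e *+ q + p))%MM.
    by apply/mnmP => i; rewrite !(mnmDE, mulmnE) addnA -mulnDr subnK.
  rewrite mfps_powD !mulrA; congr (_ * _).
  rewrite [LHS]mulrC [RHS]mulrAC; congr (_ * _).
  by rewrite exprVn -[in RHS](subnK (qM : (q <= M)%N)) exprD mulfK ?expf_neq0.
(* Only [q = 1] has the right power [y^(M-1)], and it yields [t p]. *)
have -> : (\sum_(1 <= q < M.+1) (polyC \o @mfps_const r K) q%:R^-1 *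
    (D%:P ^+ M * ('X ^+ (M - q) * t%:P ^+ q)))`_M.-1 (e *+ M + p)%MM = om ^+ M * t p.
  rewrite big_ltn // !big_add1 big_mkord coefD mfpsDE coef_sum mfps_sumE big1 ?addr0.
    rewrite /= invr1 coefCM mfps_constE mul1r -polyC_exp coefCM expr1 coefMC coefXn subn1 eqxx.
    by rewrite mul1r mfps_powD.
  move=> q _; rewrite /= coefCM -polyC_exp coefCM -polyC_exp coefMC coefXn.
  have -> : (M.-1 == M - q.+2)%N = false by have := ltn_ord q; lia.
  by rewrite mul0r !mulr0.
(* The factor [y^M] already exceeds the extracted power. *)
have -> : (\sum_(1 <= q < M.+1) (polyC \o @mfps_const r K) q%:R^-1 *
    ('X ^+ M * (D%:P ^+ (M - q) * V ^+ q)))`_M.-1 (e *+ M + p)%MM = 0.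
  rewrite coef_sum mfps_sumE big1 // => q _; rewrite /= coefCM coefXnM.
  by rewrite prednK // leqnn mulr0.
set rem := (X in _ = _ + X).
have -> : rem = 0.
  rewrite /rem coef_sum mfps_sumE big1 // => a _.
  rewrite coef_sum mfps_sumE big1 // => b _.
  (* For [a + b > M] the term has weight at least [M (lam N + lam e) + a + b], while the extracted
     monomial has weight at most [M (lam N + lam e) + M]. *)
  have [abM|Mab] := leqP (a + b) M; first by rewrite c0 // rmorph0 mul0r coef0.
  have := ltn_ord a; have := ltn_ord b; rewrite !ltnS => bM aM.
  rewrite /= coefCM mfps_constE; set U := (_ * _ : {poly fps}).
  have U_ge : wge lam (lam N) (((M - a) * lam N + a * (lam N).+1) +
      ((M - b) * lam e + b * (lam e).+1)) U.
    apply: wgeM => //; apply: wgeM => //; apply: wgeX => //.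
    - exact: wge_polyX.
    - exact: wgeC.
    - apply: wgeC => f; rewrite mfps_constE /=; case: (f =P e) => [->//|_].
      by rewrite mulr0 eqxx.
  have [->|/U_ge] := eqVneq (U`_M.-1 (e *+ M + p)%MM) 0; first by rewrite mulr0.
  have split_mul x d : (d <= M)%N -> ((M - d) * x + d * x.+1 = M * x + d)%N.
    by move=> dM; rewrite mulnS addnCA -mulnDl subnK // addnC.
  rewrite lamD lamMn !split_mul //.
  have -> : (M * lam N = M.-1 * lam N + lam N)%N by rewrite -{1}(prednK M0) mulSn addnC.
  by rewrite [(M * _)%N]mulnC; lia.
by rewrite addr0 !addr0 => /(mulfI (expf_neq0 M om0)) ->.
Qed.
End Lagrange.

(** * The initial forms of P_k *)

Section GrlexWeight.
Variables (r B : nat).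
Local Notation mon := 'X_{1..r}.
Implicit Types a b : mon.

(* [B^r] on the total degree, and lexicographic weights in base [B] on the coordinates. *)
Definition gweight (i : 'I_r) : nat := (B ^ r + B ^ (r - i.+1))%N.
Definition lam a : nat := (\sum_(i < r) a i * gweight i)%N.

Lemma lamD a b : lam (a + b)%MM = (lam a + lam b)%N.
Proof. by rewrite /lam -big_split; apply: eq_bigr => i _; rewrite mnmDE mulnDl. Qed.

(** The selected digits have place value at most [B^(h-1)], and all coordinates together sum to less
    than [B]. *)
Lemma lam_tail (p : pred 'I_r) h a : (mdeg a < B)%N ->
  (forall i, p i -> (r - i.+1 < h)%N) ->
  (\sum_(i < r | p i) a i * B ^ (r - i.+1) < B ^ h)%N.
Proof.
move=> aB ph; have B0 : (0 < B)%N by apply: leq_ltn_trans aB.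
rewrite -(ltn_pmul2r B0) big_distrl /=.
apply: (@leq_ltn_trans (B ^ h * mdeg a)); last by rewrite ltn_pmul2l // expn_gt0 B0.
rewrite mdegE big_distrr /= [X in (_ <= X)%N](bigID p) /=.
apply: leq_trans (leq_addr _ _); apply: leq_sum => i pi.
rewrite -mulnA mulnC leq_mul2r -expnSr leq_pexp2l ?orbT //; exact: ph.
Qed.

Lemma lamE a : lam a = (mdeg a * B ^ r + \sum_(i < r) a i * B ^ (r - i.+1))%N.
Proof.
rewrite mdegE big_distrl -big_split; apply: eq_bigr => i _.
by rewrite mulnDr.
Qed.

(** Only the smaller exponent needs degree below [B]. A unit of degree is worth [B^r], more than the
    whole lexicographic part of [a]; in equal degrees the same argument applies at the first
    differing coordinate. *)
Lemma lam_lt a b : (mdeg a < B)%N -> (a < b)%O -> (lam a < lam b)%N.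
Proof.
move=> aB ab; rewrite !lamE.
have [lt|gt|eqd] := ltngtP (mdeg a) (mdeg b); last 2 first.
- by move: gt; rewrite ltnNge lemc_mdeg // ltW.
- have [i0 eqj lti] := ltmcP eqd ab.
  rewrite eqd ltn_add2l (bigID (fun i : 'I_r => (i < i0)%N)) /=.
  rewrite [X in (_ < X)%N](bigID (fun i : 'I_r => (i < i0)%N)) /=.
  rewrite (eq_bigr (fun i : 'I_r => (b i * B ^ (r - i.+1))%N)) => [|i /eqj ->//].
  rewrite ltn_add2l (bigD1 i0) ?ltnn //= [X in (_ < X)%N](bigD1 i0) ?ltnn //=.
  apply: leq_trans (leq_addr _ _).
  apply: (@leq_trans ((a i0).+1 * B ^ (r - i0.+1))); last by rewrite leq_mul2r lti orbT.
  rewrite mulSn addnC ltn_add2r; apply: lam_tail => // i.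
  by rewrite -leqNgt -val_eqE /= => /andP[le ne]; have := ltn_ord i; lia.
apply: (@leq_trans ((mdeg a).+1 * B ^ r)).
  rewrite mulSn addnC ltn_add2r; apply: lam_tail => // i _.
  by have := ltn_ord i; lia.
by apply: leq_trans (leq_addr _ _); rewrite leq_mul2r lt orbT.
Qed.
End GrlexWeight.

Section Least.
Variable r : nat.
Local Notation mon := 'X_{1..r}.

Lemma least_eq (A : set mon) a : A a -> (forall m, A m -> (a <= m)%O) -> least 0%MM A = a.
Proof.
move=> Aa Amin; have [|Al lmin] := @grlex_least _ A; first by exists a.
by apply/eqP; rewrite eq_le lmin // Amin.
Qed.

Lemma ltmMn (a b : mon) n : (0 < n)%N -> (a < b)%O -> ((a *+ n)%MM < (b *+ n)%MM)%O.
Proof.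
case: n => // n _ ab; elim: n => [|n IH]; first by rewrite !mulm1n.
by rewrite mulmS [(b *+ _)%MM]mulmS; apply: ltm_add.
Qed.
End Least.

Section Wpoly.
Variables (r : nat) (K : fieldType).
Lemma wpoly_eq (U : {poly mfps r K}) a : pge a U -> symb a U != 0 -> wpoly U = a.
Proof.
move=> Ua sU; apply: least_eq => [|m [j Uj <-]]; last first.
  by have [Uw _] := w_neq0 Uj; apply: Ua Uw.
have [j Uj] : exists j, U`_j a != 0.
  apply: contrapT => H; case/eqP: sU; apply/polyP => j; rewrite coef_symb coef0.
  by apply: contrapT => /eqP Uj; apply: H; exists j.
have Uj0 : U`_j != 0 by apply: contraNneq Uj => ->.
exists j => //; have [Uw wmin] := w_neq0 Uj0.
by apply/eqP; rewrite eq_le wmin //=; apply: Ua Uw.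
Qed.
End Wpoly.

(** * Taylor expansion at the root, [i_k] and [omega0] *)

Section Truncation.
Variables (r : nat) (K : fieldType) (P : {poly mfps r K}) (y0 : mfps r K).
Local Notation fps := (mfps r K).
Local Notation mon := 'X_{1..r}.
Hypothesis r0 : (0 < r)%N.
Hypothesis Py0 : root P y0.

Definition taylor : {poly fps} := P \Po ('X + y0%:P).
Local Notation T := taylor.

Lemma taylor0 : T`_0 = 0.
Proof.
rewrite -horner_coef0 horner_comp hornerD hornerX hornerC add0r.
exact/eqP.
Qed.

Lemma taylor1 : T`_1 = P^`().[y0].
Proof.
have := coef_deriv T 0; rewrite mulr1n => <-.
rewrite -horner_coef0 deriv_comp derivD derivX derivC addr0 mulr1.
by rewrite horner_comp hornerD hornerX hornerC add0r.
Qed.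

Definition tailpart (k : mon) : fps := y0 - zpart y0 k.

Lemma tailpartE k m : tailpart k m = if (m <= k)%O then 0 else y0 m.
Proof. by rewrite mfpsDE mfpsNE /=; case: ifP; rewrite ?subrr ?subr0. Qed.

Lemma lt_gsucc (k : mon) : (k < gsucc k)%O. Proof. by have [] := gsuccP k r0. Qed.
Lemma gsucc_le (k m : mon) : (k < m)%O -> (gsucc k <= m)%O.
Proof. by have [_] := gsuccP k r0; apply. Qed.

(** This is [z_k + u^S(k) y - y0], the increment at which the Taylor expansion is evaluated to give
    [P_k]. *)
Definition shiftpoly (k : mon) : {poly fps} := (mfps_mono K (gsucc k))%:P * 'X - (tailpart k)%:P.

Lemma Pk_taylor k : Pk P y0 k = T \Po shiftpoly k.
Proof.
rewrite /Pk /T -comp_polyA comp_polyD comp_polyX comp_polyC; congr (_ \Po _).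
by rewrite /shiftpoly /tailpart polyCB; ring.
Qed.

Lemma coef_shiftpoly k i : (shiftpoly k)`_i =
  if i is i'.+1 then (if i' is 0 then mfps_mono K (gsucc k) else 0) else - tailpart k.
Proof.
rewrite coefB coefCM coefX coefC; case: i => [|[|i]] /=.
- by rewrite ?mulr0n mulr0 add0r.
- by rewrite mulr1 subr0.
- by rewrite ?mulr0n mulr0 subr0.
Qed.

Lemma pge_shift k : pge (gsucc k) (shiftpoly k).
Proof.
move=> [|[|i]] f; rewrite coef_shiftpoly ?eqxx //.
- rewrite mfpsNE oppr_eq0 tailpartE.
  by case: leP => [_|/gsucc_le//]; rewrite eqxx.
- by rewrite /=; case: (f =P gsucc k) => [->//|_]; rewrite eqxx.
Qed.

Lemma symb_shift k : symb (gsucc k) (shiftpoly k) = 'X - (y0 (gsucc k))%:P.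
Proof.
apply/polyP => -[|[|i]]; rewrite coef_symb coef_shiftpoly coefB coefX coefC.
- by rewrite mfpsNE tailpartE leNgt lt_gsucc ?mulr0n sub0r.
- by rewrite /= eqxx subr0.
- by rewrite /= ?mulr0n subr0.
Qed.

Definition phiset (s : mon) : set mon :=
  [set (w T`_j + s *+ j)%MM | j in [set j : nat | T`_j != 0]]%classic.
(* The minimum over [j] of [w(T_j) + j s], where the [T_j] are the coefficients of [taylor]; at
   [s = S(k)] it is [i_k]. *)
Definition phi s := least 0%MM (phiset s).

(** The initial form of [taylor] when [y] is given exponent [s]: only terms attaining the minimum
    [phi s] remain. *)
Definition initform s : {poly K} :=
  \poly_(j < size T) (if (T`_j != 0) && ((w T`_j + s *+ j)%MM == phi s) then T`_j (w T`_j) else 0).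

Hypothesis T1 : T`_1 != 0.

Lemma phiP s : phiset s (phi s) /\ forall m, phiset s m -> (phi s <= m)%O.
Proof.
by apply: (@grlex_least _ (phiset s)); exists (w T`_1 + s *+ 1)%MM; exists 1%N.
Qed.

Lemma coef_initform s j : (initform s)`_j =
  if (T`_j != 0) && ((w T`_j + s *+ j)%MM == phi s) then T`_j (w T`_j) else 0.
Proof.
rewrite coef_poly; case: ltnP => // Tj.
by rewrite (nth_default _ Tj) eqxx.
Qed.

Lemma initform_neq0 s : initform s != 0.
Proof.
have [[j Tj jphi] _] := phiP s; apply/eqP => /(congr1 (fun p : {poly K} => p`_j)).
rewrite coef_initform coef0 Tj jphi eqxx /=; have [Tw _] := w_neq0 Tj.
exact/eqP.
Qed.

Lemma pge_wC (s : fps) : s != 0 -> pge (w s) s%:P.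
Proof.
move=> s0 i f; rewrite coefC; have [_ wmin] := w_neq0 s0.
by case: (i =P 0%N) => _; [apply: wmin|rewrite eqxx].
Qed.

Lemma symb_C (a : mon) (s : fps) : symb a s%:P = (s a)%:P.
Proof. by apply/polyP => i; rewrite coef_symb !coefC; case: eqP. Qed.

Lemma Pk_sum k : Pk P y0 k = \sum_(j < size T) (T`_j)%:P * shiftpoly k ^+ j.
Proof. by rewrite Pk_taylor comp_polyE; apply: eq_bigr => j _; rewrite mul_polyC. Qed.

Lemma pge_Pk_term k (j : nat) : T`_j != 0 ->
  pge (w T`_j + gsucc k *+ j)%MM ((T`_j)%:P * shiftpoly k ^+ j).
Proof. by move=> Tj; apply: pgeM; [apply: pge_wC|apply/pgeX/pge_shift]. Qed.

Lemma pge_Pk k : pge (phi (gsucc k)) (Pk P y0 k).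
Proof.
rewrite Pk_sum; apply: pge_sum => j _.
have [->|Tj] := eqVneq (T`_j) 0; first by rewrite polyC0 mul0r; apply: pge0.
apply: (pgeW _ (pge_Pk_term Tj)); have [_] := phiP (gsucc k); apply.
by exists (j : nat).
Qed.

(** Terms above the minimum have no [u^phi] part; each of the others contributes its leading
    coefficient times a power of the initial form [y - c_{S(k)}]. *)
Lemma symb_Pk k : symb (phi (gsucc k)) (Pk P y0 k) =
  initform (gsucc k) \Po ('X - (y0 (gsucc k))%:P).
Proof.
have size_init : (size (map_poly polyC (initform (gsucc k))) <= size T)%N.
  by apply: leq_trans (size_poly _ _) _; apply: size_poly.
rewrite Pk_sum symb_sum /comp_poly (horner_coef_wide _ size_init).
apply: eq_bigr => j _; rewrite coef_map coef_initform /=.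
have [->|Tj] := eqVneq (T`_j) 0.
  by rewrite /= !polyC0 !mul0r; apply: (symb_gt (lt_gsucc _)); apply: pge0.
case: eqP => [<-|ne] /=.
  rewrite symbM ?symbX ?symb_C ?symb_shift //; first exact: pge_shift.
  - exact: pge_wC.
  - exact/pgeX/pge_shift.
rewrite polyC0 mul0r; apply: (symb_gt _ (pge_Pk_term Tj)).
rewrite lt_neqAle; apply/andP; split; first by apply/eqP => /esym.
by have [_] := phiP (gsucc k); apply; exists (j : nat).
Qed.

(** Composition with [y - c_{S(k)}] keeps the initial form nonzero, so cancellation cannot raise the
    minimum. *)
Lemma ikE k : ik P y0 k = phi (gsucc k).
Proof.
apply: wpoly_eq; first exact: pge_Pk.
by rewrite symb_Pk comp_poly2_eq0 ?size_XsubC // initform_neq0.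
Qed.

(** The leading exponent of [P'(y0)], by [taylor1]. *)
Definition e1 := w T`_1.

Lemma k0_spec (k : mon) : (e1 < gsucc k)%O ->
  ik P y0 k = (e1 + gsucc k)%MM /\ omega0 P y0 = T`_1 e1.
Proof.
have T1w := w_neq0 T1.
(* Terms of degree at least 2 in [y] have exponent at least [2 s], which is above [e1 + s]. *)
have phi_lt s : (e1 < s)%O -> phi s = (e1 + s)%MM.
  move=> es; apply: least_eq => [|m [j Tj <-]].
    by exists 1%N => //=; rewrite mulm1n.
  case: j Tj => [|[|j]] Tj; first by rewrite /= taylor0 eqxx in Tj.
    by rewrite mulm1n.
  have -> : (w T`_j.+2 + s *+ j.+2 = s + (w T`_j.+2 + s *+ j + s))%MM.
    by rewrite !mulmS; apply/mnmP => i; rewrite !mnmDE; lia.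
  by rewrite addmC lem_add //; apply: le_trans (ltW es) _; apply: lemc_addl.
move=> ek; rewrite ikE phi_lt //; split=> //.
have := @grlex_least _ [set k | ik P y0 (gsucc k) + gsucc k = ik P y0 k + gsucc (gsucc k)]%MM%classic.
case.
  (* The given [k] satisfies the defining equation of [k0], so the least element is not the default
     value. *)
  exists k => /=; rewrite !ikE !phi_lt //; last by apply: lt_trans (lt_gsucc _).
  by rewrite -!addmA; congr (_ + _)%MM; rewrite addmC.
rewrite -/(k0 P y0) /= => + _; rewrite !ikE; set s := gsucc (k0 P y0) => Ek0.
(* If the minimum at [S(s)] is attained in degree [j + 1], the equation forces [j S(s) <= j s],
   hence [j = 0]: the linear term is minimal at [S(s)], and then at [s]. *)
have phis : phi s = (e1 + s)%MM.
  have [[j Tj jphi] _] := phiP (gsucc s).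
  have [_ /(_ (w T`_j + s *+ j)%MM) phi_le] := phiP s.
  have {}phi_le : (phi s <= (w T`_j + s *+ j)%MM)%O by apply: phi_le; exists j.
  case: j Tj jphi phi_le => [|j] Tj jphi phi_le; first by rewrite /= taylor0 eqxx in Tj.
  have : ((gsucc s *+ j)%MM <= (s *+ j)%MM)%O.
    rewrite -(lemc_add2r (w T`_j.+1 + (gsucc s + s))%MM).
    have -> : (w T`_j.+1 + (gsucc s + s) + gsucc s *+ j = phi s + gsucc s)%MM.
      by rewrite -Ek0 -jphi mulmS; apply/mnmP => i; rewrite !mnmDE; lia.
    have -> : (w T`_j.+1 + (gsucc s + s) + s *+ j = w T`_j.+1 + s *+ j.+1 + gsucc s)%MM.
      by rewrite mulmS; apply/mnmP => i; rewrite !mnmDE; lia.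
    by rewrite lemc_add2l.
  case: j Tj jphi {phi_le} => [|j] Tj jphi; last by rewrite leNgt ltmMn // lt_gsucc.
  move=> _; apply: (@addIm _ (gsucc s)); rewrite -Ek0 -jphi mulm1n /e1.
  by apply/mnmP => i; rewrite !mnmDE; lia.
rewrite /omega0 -/s.
have -> : pik P y0 (k0 P y0) (ik P y0 (k0 P y0)) = symb (phi s) (Pk P y0 (k0 P y0)).
  by rewrite ikE.
(* The derivative of [initform s] composed with [y - c], taken at [c], is the linear coefficient of
   [initform s]. *)
rewrite symb_Pk deriv_comp derivB derivX derivC subr0 mulr1 horner_comp.
rewrite hornerD hornerN hornerX hornerC subrr horner_coef0 coef_deriv coef_initform mulr1n.
by rewrite T1 mulm1n phis eqxx.
Qed.
End Truncation.

(** * Simple roots and the resultant *)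

(** The Sylvester matrix sends the vector of powers of [y] to the values of the shifted polynomials;
    at a root of [p] only multiples of [q.[y]] survive. *)
Lemma resultant_dvd_horner (R : comNzRingType) (p q : {poly R}) y :
  (1 < size p)%N -> root p y -> exists d, resultant p q = q.[y] * d.
Proof.
move=> p1 py.
have dS0 : (0 < (size q).-1 + (size p).-1)%N by lia.
pose v : 'cV[R]_((size q).-1 + (size p).-1) := \col_j y ^+ j.
have band_v n (g : {poly R}) : (size g + n <= ((size q).-1 + (size p).-1).+1)%N ->
    (lin1_mx (poly_rV \o g \o* rVpoly) : 'M[R]_(n, _)) *m v = g.[y] *: \col_i y ^+ i.
  move=> sz; apply/matrixP => i j; rewrite !mxE.
  transitivity (g * 'X^i).[y]; last by rewrite hornerM hornerXn.
  rewrite (@horner_coef_wide _ ((size q).-1 + (size p).-1)).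
    by apply: eq_bigr => l _; rewrite !mxE /= rVpoly_delta commr_polyXn.
  have [->|g0] := eqVneq g 0; first by rewrite mul0r size_poly0.
  apply: leq_trans (size_polyMleq _ _) _; rewrite size_polyXn.
  by have := ltn_ord i; lia.
have Sv : Sylvester_mx p q *m v = q.[y] *: col_mx 0 (\col_i y ^+ i).
  rewrite /Sylvester_mx mul_col_mx !band_v; first last.
  - by rewrite addnC -addnS leq_add2l leqSpred.
  - by rewrite -addSn leq_add2r leqSpred.
  by rewrite (eqP py) scale0r scale_col_mx scaler0.
(* The adjugate produces the determinant times [v]; row [0], where [y^0 = 1], isolates the
   resultant. *)
have := congr1 (fun x => \adj (Sylvester_mx p q) *m x) Sv.
rewrite mulmxA mul_adj_mx -scalemxAr => /matrixP/(_ (Ordinal dS0) 0).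
rewrite mul_scalar_mx !mxE /= expr0 mulr1 /resultant => ->; by eexists.
Qed.

Lemma ord_supp r (K : fieldType) (s : mfps r K) : s != 0 ->
  exists2 m, s m != 0 & mdeg m = ord s.
Proof.
move=> s0; pose A := (@mdeg r @` supp s)%classic.
have [a sa] : exists a, `[< A a >].
  by exists (mdeg (w s)); apply/asboolP; exists (w s) => //; have [] := w_neq0 s0.
have [n /asboolP An nmin] := ex_minnP (ex_intro (fun n => `[< A n >]) a sa).
have [m sm mE] : A (ord s).
  have [] // := @xgetI _ 0%N (A `&` lbound A)%classic n.
  by split=> // j /asboolP/nmin; rewrite leEnat.
by exists m.
Qed.

Section SimpleRoot.
Variables (r : nat) (K : fieldType) (L : closedFieldType).
Variable iota : {rmorphism fpsfrac r K -> L}.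
Variables (P : {poly mfps r K}) (y0 : mfps r K).
Hypothesis P0 : P != 0.
Hypothesis simpleP : only_simple_roots iota P.
Hypothesis Py0 : root P y0.

Lemma size_root_gt1 : (1 < size P)%N.
Proof.
rewrite ltnNge; apply/negP => /size1_polyC Pc; case/negP: P0; move: Py0.
by rewrite Pc rootE hornerC polyC_eq0.
Qed.

Let f : {rmorphism mfps r K -> L} := iota \o @tofrac _.
Local Notation PL := (map_poly f P).

Let f_inj : injective f.
Proof. by move=> a b /fmorph_inj/eqP; rewrite tofrac_eq => /eqP. Qed.

Lemma no_double_root x : root PL x -> ~~ root PL^`() x.
Proof.
move=> Px; apply/negP => dPx; have := simpleP Px.
have PL0 : PL != 0 by rewrite -(rmorph0 (map_poly f)) (inj_eq (map_inj_poly f_inj _)) ?rmorph0.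
have /factor_theorem[q PE] := Px.
have /factor_theorem[q' qE] : root q x.
  move: dPx; rewrite PE derivM derivXsubC mulr1 !rootE hornerD hornerM.
  by rewrite hornerXsubC subrr mulr0 add0r.
have : (1 < mup x PL)%N.
  by rewrite mup_geq // PE qE -mulrA -expr2 dvdp_mulIr.
by move=> /[swap] ->.
Qed.

Lemma deriv_root_neq0 : P^`().[y0] != 0.
Proof.
have := @no_double_root (f y0); rewrite /root deriv_map !horner_map (eqP Py0) rmorph0 eqxx.
by move=> /(_ isT); apply: contraNneq => ->; rewrite rmorph0.
Qed.

(** A vanishing resultant gives a nonconstant common divisor of [P] and [P'], whose root in the
    closed field would be a double root. *)
Lemma resultant_neq0 : resultant P P^`() != 0.
Proof.
rewrite resultant_eq0 -leqNgt leqNgt; apply/negP => g1.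
have /andP[gP gdP] : (gcdp P P^`() %| P) && (gcdp P P^`() %| P^`()).
  by rewrite dvdp_gcdl dvdp_gcdr.
pose g := map_poly f (gcdp P P^`()).
have /closed_rootP[x gx] : size g != 1%N.
  by rewrite size_map_inj_poly ?rmorph0 // neq_ltn g1 orbT.
(* Divisibility over [K[[u]]] holds up to a nonzero scalar, which stays nonzero under the injection
   [f]. *)
have root_div (q : {poly mfps r K}) : gcdp P P^`() %| q -> root (map_poly f q) x.
  move=> /Pdiv.Idomain.dvdpP[[c h] /= c0 qE].
  have := congr1 (map_poly f) qE; rewrite map_polyZ rmorphM /= => E.
  have : (f c *: map_poly f q).[x] = 0 by rewrite E hornerM (eqP gx) mulr0.
  rewrite hornerZ => /eqP; rewrite mulf_eq0 -(rmorph0 f) (inj_eq f_inj) (negPf c0).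
  by rewrite rmorph0.
by have := no_double_root (root_div _ gP); rewrite deriv_map (root_div _ gdP).
Qed.

(** The resultant is a multiple of [P'(y0)], so every exponent in its support dominates one in the
    support of [P'(y0)]. *)
Lemma mdeg_w_deriv_le : (mdeg (w P^`().[y0]) <= ord (resultant P P^`()))%N.
Proof.
have [d dE] := resultant_dvd_horner P^`() size_root_gt1 Py0.
have [m [m0 <-]] : exists m, resultant P P^`() m != 0 /\ mdeg m = ord (resultant P P^`()).
  by have [m /= m0 mE] := ord_supp resultant_neq0; exists m.
move: m0; rewrite dE => /mfpsM_neq0[a [b [-> Pa _]]].
have [_ /(_ _ Pa)/lemc_mdeg le] := w_neq0 deriv_root_neq0.
by apply: leq_trans le _; rewrite mdegD leq_addr.
Qed.
End SimpleRoot.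

(** * The recursion polynomial at k *)

Section Recursion.
Variables (r : nat) (K : fieldType) (P : {poly mfps r K}) (y0 : mfps r K) (k : 'X_{1..r}).
Local Notation fps := (mfps r K).
Local Notation mon := 'X_{1..r}.
Hypothesis charK : [pchar K] =i pred0.
Hypothesis r0 : (0 < r)%N.
Hypothesis Py0 : root P y0.
Local Notation T := (taylor P y0).
Hypothesis T1 : T`_1 != 0.
Local Notation N := (gsucc k).
Local Notation e := (e1 P y0).
Hypothesis eN : (e < N)%O.
Local Notation om := (T`_1 e).
Local Notation B := (mdeg (e + N)%MM).+1.
Local Notation lam := (lam B).
Local Notation t := (tailpart y0 N).
Local Notation D := (mfps_const r om * mfps_mono K e).

Definition Rpoly : {poly fps} := P \Po ('X + (zpart y0 N)%:P).
Local Notation R := Rpoly.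
Local Notation Q := (D%:P * 'X - R).

(** Here [om] is the leading coefficient of [P'(y0)], and [B] exceeds the degrees of [e], [N] and
    their sum, so [lam] increases strictly above each of them. *)
Lemma om_neq0 : om != 0. Proof. by have [] := w_neq0 T1. Qed.

Lemma lamN_lt m : (N < m)%O -> (lam N < lam m)%N.
Proof. by apply: lam_lt; rewrite mdegD ltnS leq_addl. Qed.
Lemma lame_lt m : (e < m)%O -> (lam e < lam m)%N.
Proof. by apply: lam_lt; rewrite mdegD ltnS leq_addr. Qed.

Lemma root_Rpoly : root R t.
Proof.
rewrite rootE horner_comp hornerD hornerX hornerC /tailpart subrK.
exact: Py0.
Qed.

Lemma tail_ge f : t f != 0 -> (lam N < lam f)%N.
Proof.
by rewrite tailpartE; case: leP => [_|/lamN_lt//]; rewrite eqxx.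
Qed.

Lemma Rpoly_taylor : R = T \Po ('X - t%:P).
Proof.
rewrite /taylor -comp_polyA comp_polyD comp_polyX comp_polyC; congr (_ \Po _).
by rewrite /tailpart polyCB; ring.
Qed.

(** From [R = T_1 (y - t) + T2 (y - t)^2]: [D] removes the leading term of the linear coefficient,
    [t] weighs more than [lam N], and the square weighs at least [2 lam N]. *)
Lemma Q_ge : wge lam (lam N) (lam e + lam N).+1 Q.
Proof.
have lamDB := lamD B.
have TE : T = T`_1 *: 'X + drop_poly 2 T * 'X^2.
  rewrite -{1}[T](poly_take_drop 2); congr (_ + _).
  apply/polyP => i; rewrite coef_take_poly coefZ coefX.
  by case: i => [|[|i]] /=; rewrite ?taylor0 ?mulr1 ?mulr0.
pose T2 := drop_poly 2 T \Po ('X - t%:P).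
have RE : R = (T`_1)%:P * ('X - t%:P) + T2 * ('X - t%:P) ^+ 2.
  by rewrite Rpoly_taylor {1}TE comp_polyD comp_polyZ comp_polyX comp_polyM comp_Xn_poly mul_polyC.
have -> : Q = (D - T`_1)%:P * 'X + (T`_1)%:P * t%:P - T2 * ('X - t%:P) ^+ 2.
  by rewrite {}RE polyCB; ring.
have t_wge : wge lam (lam N) (lam N).+1 t%:P by apply: wgeC; apply: tail_ge.
have X_wge : wge lam (lam N) (lam N) ('X : {poly fps}) := wge_polyX lam (lam N).
have [_ wmin] := w_neq0 T1.
apply: wgeB; first apply: wgeD.
- rewrite -addSn; apply: wgeM => //; apply: wgeC => f.
  rewrite mfpsDE mfpsNE mfps_constE /=; case: (f =P e) => [->|/eqP fe].
    by rewrite mulr1 subrr eqxx.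
  rewrite mulr0 sub0r oppr_eq0 => /wmin ef; apply: lame_lt.
  by rewrite lt_neqAle eq_sym fe.
- rewrite -addnS; apply: wgeM => //; apply: wgeC => f /wmin.
  by rewrite le_eqVlt => /orP[/eqP<-//|/lame_lt/ltnW].
- apply: (@wgeW _ _ _ _ _ (0 + 2 * lam N)); first by have := lame_lt eN; lia.
  apply: wgeM => //; apply: wgeX => //; apply: wgeB => //.
  by apply: wgeW t_wge.
Qed.

Lemma root_coef M p : (N < p)%O -> (0 < M)%N -> (lam p <= M + lam N)%N ->
  y0 p = \sum_(1 <= q < M.+1) q%:R^-1 * om^-1 ^+ q * (Q ^+ q)`_q.-1 (e *+ q + p)%MM.
Proof.
move=> Np M0 pM.
rewrite -(lagrange_inversion charK (lamD B) om_neq0 root_Rpoly tail_ge Q_ge M0 pM).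
by rewrite tailpartE leNgt Np.
Qed.

Definition Gpoly : {poly fps} := Pk P y0 k \Po ('X + (mfps_const r (y0 N))%:P).
Local Notation uNX := ((mfps_mono K N)%:P * 'X : {poly fps}).

Lemma zpart_gsucc : zpart y0 N = zpart y0 k + mfps_mono K N * mfps_const r (y0 N).
Proof.
apply/mfpsP => m; rewrite mfpsDE mulrC mfps_constE /=.
have [->|mN] := eqVneq m N; first by rewrite lexx leNgt (lt_gsucc r0) add0r mulr1.
rewrite mulr0 addr0 le_eqVlt (negPf mN) /=; case: (leP m k) => [mk|/(gsucc_le r0)].
  by rewrite (le_lt_trans mk) // lt_gsucc.
by rewrite leNgt => /negPf->.
Qed.

Lemma GpolyE : Gpoly = P \Po ((zpart y0 N)%:P + uNX).
Proof.
rewrite /Gpoly /Pk -comp_polyA comp_polyD comp_polyC comp_polyM comp_polyX comp_polyC.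
by rewrite zpart_gsucc polyCD polyCM; congr (_ \Po _); ring.
Qed.

Lemma Gpoly_R : Gpoly = R \Po uNX.
Proof.
by rewrite GpolyE /R -comp_polyA comp_polyD comp_polyX comp_polyC addrC.
Qed.

(** Up to the factor [- om u^i_k], this is the polynomial whose coefficients are the [b_{l,m}]. *)
Definition Grem : {poly fps} := Gpoly - (mfps_const r om * mfps_mono K (ik P y0 k))%:P * 'X.

Lemma ikN : ik P y0 k = (e + N)%MM.
Proof. by have [] := k0_spec r0 Py0 T1 eN. Qed.
Lemma omega0N : omega0 P y0 = om.
Proof. by have [] := k0_spec r0 Py0 T1 eN. Qed.

Lemma Grem_Q : Grem = - (Q \Po uNX).
Proof.
rewrite /Grem Gpoly_R ikN comp_polyB comp_polyM comp_polyC comp_polyX opprB.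
by rewrite -mfps_monoM !polyCM; congr (_ - _); ring.
Qed.

Lemma coef_comp_mono (U : {poly fps}) m : (U \Po uNX)`_m = mfps_mono K (N *+ m)%MM * U`_m.
Proof.
rewrite comp_polyE coef_sum.
have E i : (U`_i *: uNX ^+ i)`_m = if i == m then mfps_mono K (N *+ m)%MM * U`_m else 0.
  rewrite coefZ exprMn -polyC_exp coefCM coefXn mfps_monoX [m == i]eq_sym.
  case: (i =P m) => [->|_]; first by rewrite mulr1 mulrC.
  by rewrite !mulr0.
under eq_bigr => i _ do rewrite E.
rewrite -big_mkcond; have [mU|Um] := ltnP m (size U).
  by rewrite (big_pred1 (Ordinal mU)).
rewrite big1 => [|i /eqP im]; first by rewrite nth_default ?mulr0.
by have := ltn_ord i; rewrite im ltnNge Um.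
Qed.

(** The substitution of [u^N y] for [y] multiplies the coefficient of [y^(q-1)] by [u^((q-1)N)]; the
    sign comes from [Grem_Q]. *)
Lemma Grem_pow q p : (0 < q)%N -> (Q ^+ q)`_q.-1 (e *+ q + p)%MM =
  (-1) ^+ q * (Grem ^+ q)`_q.-1 (e *+ q + p + N *+ q.-1)%MM.
Proof.
move=> q0; have -> : Grem ^+ q = (mfps_const r ((-1) ^+ q))%:P * (Q ^+ q \Po uNX).
  have -> : mfps_const r ((-1) ^+ q : K) = (-1) ^+ q :> fps by rewrite rmorphXn rmorphN1.
  rewrite Grem_Q -[- (_ \Po _)]mulN1r exprMn polyC_exp polyCN polyC1; congr (_ * _).
  by elim: (q) => [|n IH]; rewrite ?expr0 ?rmorph1 // !exprS comp_polyM IH.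
rewrite coefCM mfps_constE mulrA -exprMn mulrNN mulr1 expr1n mul1r coef_comp_mono.
by rewrite [(_ + _ *+ _)%MM]addmC mfps_mono_add.
Qed.

(** [Q_ge] gives [lam f > lam i_k]; since [i_k] has degree below [B], an exponent [f < i_k] would
    have the smaller weight. *)
Lemma Grem_gt m f : Grem`_m f != 0 -> (ik P y0 k < f)%O.
Proof.
rewrite Grem_Q coefN mfpsNE oppr_eq0 coef_comp_mono mfps_monoE.
case: ifP => [Nf /Q_ge wf|]; last by rewrite eqxx.
have lf : (lam (ik P y0 k) < lam f)%N.
  by rewrite ikN lamD -{1}(submK Nf) lamD (weightMn _ _ (lamD B)) mulnC.
rewrite ltNge le_eqVlt; apply/negP => /orP[/eqP fE|flt].
  by rewrite fE ltnn in lf.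
have := @lam_lt _ B _ _ _ flt; rewrite ltnS => lt.
suff : (lam f < lam (ik P y0 k))%N by rewrite ltnNge (ltnW lf).
apply: lt; rewrite -ikN; exact: lemc_mdeg (ltW flt).
Qed.
End Recursion.

(** * Exponent vectors and powers of truncated series *)

Section IntVectorTheory.
Variable r : nat.
Local Notation mon := 'X_{1..r}.
Implicit Types (a b c : zvec r) (m n : mon).

Lemma zvE m i : zv m i = (m i)%:Z. Proof. by rewrite ffunE. Qed.
Lemma zvD m n : zv (m + n)%MM = zv m + zv n.
Proof. by apply/ffunP => i; rewrite !ffunE mnmDE PoszD. Qed.
Lemma zv0 : zv (0%MM : mon) = 0.
Proof. by apply/ffunP => i; rewrite !ffunE mnm0E. Qed.
Lemma zvMn m d : zv (m *+ d)%MM = zv m *+ d.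
Proof. by elim: d => [|d IH]; rewrite ?mulm0n ?zv0 ?mulr0n // mulmS zvD IH mulrS. Qed.
Lemma zv_inj : injective (@zv r).
Proof.
move=> m n /ffunP mn; apply/mnmP => i; have := mn i.
by rewrite !zvE => -[].
Qed.
Lemma zle_zv m n : zle (zv m) (zv n) = (m <= n)%MM.
Proof. by apply/forallP/mnm_lepP => H i; have := H i; rewrite !zvE lez_nat. Qed.

Definition zabs a : mon := [multinom absz (a i) | i < r].
Lemma zvK : cancel (@zv r) zabs.
Proof. by move=> m; apply/mnmP => i; rewrite mnmE zvE. Qed.
Lemma zabsK a : zle 0 a -> zv (zabs a) = a.
Proof.
move=> /forallP a0; apply/ffunP => i; rewrite zvE mnmE.
by have := a0 i; rewrite ffunE => ai; rewrite gez0_abs.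
Qed.
Lemma zle0_zv m : zle 0 (zv m).
Proof. by rewrite -zv0 zle_zv; apply/mnm_lepP => i; rewrite mnm0E. Qed.

Lemma zvB m n : (m <= n)%MM -> zv (n - m)%MM = zv n - zv m.
Proof. by move=> mn; rewrite -{2}(submK mn) zvD addrK. Qed.

Lemma zdegD a b : zdeg (a + b) = zdeg a + zdeg b.
Proof. by rewrite /zdeg -big_split; apply: eq_bigr => i _; rewrite ffunE. Qed.

Lemma zgrlex_leD a b c : zgrlex_le (a + c) (b + c) = zgrlex_le a b.
Proof.
rewrite /zgrlex_le (inj_eq (addIr c)) /zgrlex_lt !zdegD ltrD2r (inj_eq (addIr _)).
congr (_ || (_ || (_ && _))); apply: eq_existsb => i; rewrite !ffunE ltrD2r.
congr (_ && _); apply: eq_forallb => j.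
by rewrite !ffunE (inj_eq (addIr _)).
Qed.

Lemma zgrlex_le_zv m n : zgrlex_le (zv m) (zv n) = (m <= n)%O.
Proof. by rewrite /zgrlex_le zgrlex_lt_nat (inj_eq zv_inj) le_eqVlt. Qed.

Definition mgrade (I : choiceType) (deg : I -> mon) (L : family I) : mon :=
  (\big[+%MM/0%MM]_(i <- finsupp L) (deg i *+ L i))%MM.

Lemma zv_mgrade (I : choiceType) (deg : I -> mon) L :
  zv (mgrade deg L) = fgrade (fun x => zv (deg x)) L.
Proof.
rewrite /fgrade /mgrade (big_morph (@zv r) zvD zv0).
by apply: eq_bigr => i _; rewrite zvMn.
Qed.
End IntVectorTheory.

Section Expansion.
Variables (r : nat) (K : fieldType).
Local Notation fps := (mfps r K).
Local Notation mon := 'X_{1..r}.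

Lemma prod_series (I : choiceType) (c : I -> K) (deg : I -> mon) (s : seq I) (M : family I) :
  uniq s -> {subset finsupp M <= s} ->
  \prod_(x <- s) (mfps_const r (c x) * mfps_mono K (deg x)) ^+ M x =
  mfps_const r (fmono c M) * mfps_mono K (mgrade deg M) :> fps.
Proof.
move=> us Ms; rewrite /fmono /mgrade.
rewrite (big_morph (@mfps_mono r K) (fun a b => esym (mfps_monoM K a b)) (mfps_mono0 r K)).
rewrite rmorph_prod -big_split /=.
rewrite (@big_finsupp _ _ _ _ (fun x n => mfps_const r (c x ^+ n) * mfps_mono K (deg x *+ n)%MM) _ s) //.
  by apply: eq_bigr => x _; rewrite exprMn rmorphXn mfps_monoX.
by move=> x; rewrite mulm0n mfps_mono0 expr0 rmorph1 mulr1.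
Qed.

Lemma coef_linear_pow (R : comNzRingType) (a b : R) j m :
  ((a%:P + b%:P * 'X) ^+ j)`_m = (a ^+ (j - m) * b ^+ m) *+ 'C(j, m).
Proof.
rewrite exprDn coef_sum.
have E (i : 'I_j.+1) : (a%:P ^+ (j - i) * (b%:P * 'X) ^+ i *+ 'C(j, i))`_m =
    if i == m :> nat then (a ^+ (j - m) * b ^+ m) *+ 'C(j, m) else 0.
  rewrite coefMn exprMn mulrA -!polyC_exp -polyCM coefCM coefXn eq_sym.
  case: (i =P m :> nat) => [->|_]; first by rewrite mulr1.
  by rewrite mulr0 mul0rn.
under eq_bigr => i _ do rewrite E.
rewrite -big_mkcond; have [mj|jm] := leqP m j.
  by rewrite (big_pred1 (Ordinal (mj : (m < j.+1)%N))).
rewrite big1 => [|i /eqP im]; first by rewrite bin_small ?mulr0n.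
by have := ltn_ord i; lia.
Qed.

(** Binomial times multinomial: the origin of the factor [j! / (m! L!)] in [e_T]. *)
Lemma fact_quot (I : choiceType) m j (L : family I) : (m <= j)%N -> fcard L = (j - m)%N ->
  ('C(j, m) * ((j - m)`! %/ ffact L) = j`! %/ (m`! * ffact L))%N.
Proof.
move=> mj cL; have /dvdnP[d dE] : (ffact L %| (j - m)`!)%N by rewrite -cL dvdn_ffact.
have F0 : (0 < ffact L)%N by rewrite prodn_gt0 // => y; rewrite fact_gt0.
rewrite -(bin_fact mj) dE mulnK // [(m`! * (d * _))%N]mulnCA mulnA mulnK //.
by rewrite muln_gt0 fact_gt0.
Qed.

Lemma power_series (y0 : fps) (U : seq mon) h : uniq U ->
  (\sum_(i <- U) mfps_const r (y0 i) * mfps_mono K i) ^+ h =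
  \sum_(L <- families U h) (h`! %/ ffact L)%:R *
    (mfps_const r (fmono y0 L) * mfps_mono K (mgrade id L)) :> fps.
Proof.
move=> uU; rewrite multinomial // big_seq [RHS]big_seq; apply: eq_bigr => L /mem_families[] // LU _.
by rewrite -(prod_series _ _ uU).
Qed.
End Expansion.

(** * Expansion over the index set *)

Lemma greatest_eq (A : set nat) b : (exists n, A n) -> (forall n, A n -> (n <= b)%N) ->
  A (greatest 0%N A) /\ forall n, A n -> (n <= greatest 0%N A)%N.
Proof.
move=> [a Aa] Ab; have exA : exists n, `[< A n >] by exists a; apply/asboolP.
have [n /asboolP|n /asboolP An nmax] := ex_maxnP exA (m := b); first exact: Ab.
have [] := @xgetI _ 0%N (A `&` ubound A)%classic n.
  by split=> // j /asboolP/nmax; rewrite leEnat.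
by rewrite -/(greatest 0%N A) => Ag gub; split=> // j /gub; rewrite leEnat.
Qed.

Lemma subr_sub_addK (V : zmodType) (a b c : V) : a = b + (c + (a - c - b)).
Proof. by rewrite -addrA -opprD addrA [b + c]addrC [RHS]addrC subrK. Qed.

Section EIndices.
Variables (r dy : nat) (K : fieldType) (P : {poly mfps r K}) (y0 : mfps r K) (k : 'X_{1..r}).
Local Notation fps := (mfps r K).
Local Notation mon := 'X_{1..r}.
Hypothesis r0 : (0 < r)%N.
Hypothesis szP : (size P <= dy.+1)%N.
Local Notation N := (gsucc k).
Local Notation i0 := (ik P y0 k).

(** The exponent of [u] before division by [u^i_k]; for admissible indices it is nonnegative and
    [zabs] loses nothing. *)
Definition flat (x : eindex r) : mon := zabs (ix_l x + zv i0).

Definition below : seq mon :=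
  [seq bmnm m | m <- enum {: 'X_{1..r < (mdeg N).+1}} & (bmnm m <= N)%O].

Lemma below_uniq : uniq below.
Proof. by rewrite map_inj_uniq; [exact/filter_uniq/enum_uniq|move=> a b ab; apply: val_inj]. Qed.

Lemma mem_below m : (m \in below) = (m <= N)%O.
Proof.
apply/mapP/idP => [[b]|mN]; first by rewrite mem_filter => /andP[bN _] ->.
have md : (mdeg m < (mdeg N).+1)%N by rewrite ltnS lemc_mdeg.
by exists (BMultinom md); rewrite // mem_filter /= mN mem_enum.
Qed.

(** The exponent [i] is determined by [f], [m] and [L]; [fiber_ok] ensures that the truncated
    subtraction is exact. *)
Definition mkindex (f : mon) (m : nat) (jL : nat * family mon) : eindex r :=
  EIndex (zv f - zv i0) m (f - (N *+ m + mgrade id jL.2))%MM jL.1 jL.2.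

Definition fiber_index m : seq (nat * family mon) :=
  [seq (j, L) | j <- iota 0 dy.+1, L <- families below (j - m)%N].

Definition fiber_ok (f : mon) m (jL : nat * family mon) :=
  (m <= jL.1)%N && (N *+ m + mgrade id jL.2 <= f)%MM.

(* The admissible indices whose term contributes to the coefficient of [u^f y^m]. *)
Definition fiber (f : mon) m : seq (eindex r) :=
  [seq mkindex f m jL | jL <- fiber_index m & fiber_ok f m jL].

Lemma flat_mkindex f m jL : flat (mkindex f m jL) = f.
Proof. by rewrite /flat /= subrK zvK. Qed.

Lemma fiber_index_uniq m : uniq (fiber_index m).
Proof.
apply: allpairs_uniq_dep => [|j _|]; first exact: iota_uniq.
  exact/families_uniq/below_uniq.
by move=> [j L] [j' L'] _ _ /= [-> ->].
Qed.

Lemma fiber_uniq f m : uniq (fiber f m).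
Proof.
rewrite map_inj_uniq ?filter_uniq ?fiber_index_uniq //.
by move=> [j L] [j' L'] [_ -> ->].
Qed.

Lemma mem_fiber_index m j L : (j, L) \in fiber_index m <->
  [/\ (j <= dy)%N, is_tuple_upto N L & fcard L = (j - m)%N].
Proof.
split=> [/allpairsPdep[j' [L' [jy /mem_families L's [-> ->]]]]|[jdy LN cL]].
  have [|Lsub cL] := L's; first exact: below_uniq.
  by split=> //; [move: jy; rewrite mem_iota|move=> i /Lsub; rewrite mem_below].
apply/allpairsPdep; exists j, L; rewrite mem_iota; split=> //.
apply/mem_families; first exact: below_uniq.
by split=> // i /LN; rewrite mem_below.
Qed.

(** As a successor, [N] is nonzero, so the degree of [f] bounds the candidates and the maximum in
    [mmax] is attained. *)
Lemma mmax_ge f m : (m <= dy)%N -> (N *+ m <= f)%MM -> (m <= mmax P y0 dy k (zv f - zv i0)%R)%N.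
Proof.
move=> mdy Nmf; rewrite leq_min mdy /=.
have [||_] := @greatest_eq [set m : nat | zgrlex_le (zv N *+ m) (zv f - zv i0 + zv i0)]%classic (mdeg f).
- by exists 0%N => /=; rewrite mulr0n subrK -(zv0 r) zgrlex_le_zv le0m.
- move=> n /=; rewrite subrK -zvMn zgrlex_le_zv => /lemc_mdeg; rewrite mdegMn.
  apply: leq_trans; rewrite leq_pmull // lt0n mdeg_eq0.
  by apply/eqP => N0; have := lt_gsucc r0 k; rewrite N0 ltNge le0m.
by apply; rewrite /= subrK -zvMn zgrlex_le_zv; apply: lem_leo.
Qed.

Lemma mem_fiber f m x : (i0 < f)%O ->
  x \in fiber f m <-> [/\ eindex_ok P y0 dy k x, flat x = f & ix_m x = m].
Proof.
move=> i0f; split=> [/mapP[[j L]]|].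
  rewrite mem_filter => /andP[/andP[/= mj le] /mem_fiber_index[jdy LN cL]] ->.
  have zl : zv f - zv i0 + zv i0 - zv N *+ m = zv (f - N *+ m)%MM.
    by rewrite subrK -zvMn zvB //; apply: lepm_trans le; apply: lem_addr.
  split=> //; last exact: flat_mkindex.
  split=> /=.
  - by rewrite subrK zle0_zv.
  - by rewrite -(zgrlex_leD _ _ (zv i0)) !subrK zgrlex_le_zv; apply: gsucc_le.
  - apply: mmax_ge; first exact: leq_trans jdy.
    by apply: lepm_trans le; apply: lem_addr.
  - by rewrite zl zle_zv -submDA; apply: lem_subr.
  - split=> //; first by rewrite mj.
    rewrite zl -[LHS](zv_mgrade id); apply: (canRL (addrK _)); rewrite -zvD; congr zv.
    apply/mnmP => i; rewrite !(mnmDE, mnmBE).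
    have := mnm_lepP le i; rewrite mnmDE; clear.
    by move: (f i) ((N *+ m)%MM i) (mgrade id L i) => a b c; lia.
case=> -[zl0 zlS mle zi [/andP[mj jdy] LN cL gL]] fx mx.
have fE : zv f = ix_l x + zv i0 by rewrite -fx zabsK.
have fdec : (f = ix_i x + (N *+ m + mgrade id (ix_L x)))%MM.
  by apply: zv_inj; rewrite !zvD zvMn zv_mgrade gL -mx fE -subr_sub_addK.
apply/mapP; exists (ix_j x, ix_L x).
  rewrite mem_filter /fiber_ok /= -mx mj {1}fdec -mx lem_addl /=.
  by apply/mem_fiber_index.
case: x {zl0 zlS mle zi mj jdy LN cL gL} fx mx fE fdec => l m' i j L /= fx mx fE fdec.
rewrite /mkindex /= mx fE addrK; congr EIndex => //.
by rewrite [in RHS]fdec addmK.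
Qed.
(** The contribution of one index to the coefficient of [u^(flat x) y^(ix_m x)]. *)
Definition eterm (x : eindex r) : K :=
  ((ix_j x)`! %/ ((ix_m x)`! * ffact (ix_L x)))%:R * (P`_(ix_j x) (ix_i x) * fmono y0 (ix_L x)).

Lemma zpart_below : zpart y0 N = \sum_(i <- below) mfps_const r (y0 i) * mfps_mono K i.
Proof.
apply/mfpsP => m; rewrite mfps_sumE.
have E i : (mfps_const r (y0 i) * mfps_mono K i) m = if i == m then y0 m else 0.
  by rewrite mfps_constE /= eq_sym; case: (i =P m) => [->|_]; rewrite ?mulr1 ?mulr0.
under eq_bigr => i _ do rewrite E.
rewrite -big_mkcond -big_filter /= -mem_below; case: ifPn => mb.
  by rewrite filter_pred1_uniq ?below_uniq // big_seq1.
rewrite big_filter big_seq_cond big1 // => i /andP[ib /eqP im].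
by rewrite -im ib in mb.
Qed.

(** The binomial formula expands [(z_N + u^N y)^j], and the multinomial formula expands the
    remaining power of [z_N]. *)
Lemma coef_Gpoly f m : (Gpoly P y0 k)`_m f =
  \sum_(jL <- fiber_index m | fiber_ok f m jL) eterm (mkindex f m jL).
Proof.
rewrite (GpolyE P y0 k r0) comp_polyE coef_sum mfps_sumE.
rewrite [RHS]big_mkcond /fiber_index big_allpairs_dep -[iota 0 dy.+1]/(index_iota 0 dy.+1) big_mkord.
rewrite (big_ord_widen_cond _ xpredT
  (fun j => (P`_j *: ((zpart y0 N)%:P + (mfps_mono K N)%:P * 'X) ^+ j)`_m f) szP).
rewrite big_mkcond; apply: eq_bigr => j _ /=.
have -> : (if (j < size P)%N
   then (P`_j *: ((zpart y0 N)%:P + (mfps_mono K N)%:P * 'X) ^+ j)`_m f else 0)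
   = (P`_j *: ((zpart y0 N)%:P + (mfps_mono K N)%:P * 'X) ^+ j)`_m f.
  by case: ltnP => // Pj; rewrite (nth_default _ Pj) scale0r coef0.
rewrite coefZ coef_linear_pow; have [mj|jm] := leqP m j; last first.
  rewrite bin_small // mulr0n mulr0 mfps0E big1 // => L _.
  by rewrite /fiber_ok /= leqNgt jm.
rewrite zpart_below (power_series _ _ below_uniq) mfps_monoX mulrnAr mfpsMnE.
rewrite mulr_suml mulr_sumr mfps_sumE.
rewrite -sumrMnl big_seq [RHS]big_seq.
apply: eq_bigr => L /mem_families[]; first exact: below_uniq.
move=> Lb cL; rewrite /fiber_ok mj andTb.
have -> : P`_j * (((j - m)`! %/ ffact L)%:R *
      (mfps_const r (fmono y0 L) * mfps_mono K (mgrade id L)) * mfps_mono K (N *+ m)%MM) =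
   (mfps_const r (fmono y0 L) * (mfps_mono K (N *+ m + mgrade id L)%MM * P`_j)) *+ ((j - m)`! %/ ffact L).
  by rewrite -mfps_monoM -mulr_natl; ring.
rewrite mfpsMnE mfps_constE mfps_monoE -mulrnA mulnC fact_quot //.
case: ifP => _; last by rewrite mulr0 mul0rn.
by rewrite /eterm [RHS]mulr_natl mulrC.
Qed.
End EIndices.

(** * Powers of the recursion polynomial *)

Section Agreement.
Variables (r : nat) (K : fieldType) (d : nat).
Local Notation fps := (mfps r K).
Implicit Types U V : {poly fps}.

(** Congruence modulo total degree above [d] in [u]; being multiplicative, it lets a coefficient of
    a power be computed from finitely many indices. *)
Definition agree U V := forall m f, (mdeg f <= d)%N -> U`_m f = V`_m f.

Lemma agreeM U V U' V' : agree U U' -> agree V V' -> agree (U * V) (U' * V').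
Proof.
move=> UU VV m f fd; rewrite !coefM !mfps_sumE; apply: eq_bigr => i _ /=.
apply: eq_bigr => -[a b] /= _.
by rewrite UU ?VV // (leq_trans _ fd) // -ltnS bmdeg.
Qed.

Lemma agreeX U V q : agree U V -> agree (U ^+ q) (V ^+ q).
Proof. by move=> UV; elim: q => [|q IH] //; rewrite !exprS; apply: agreeM. Qed.
End Agreement.

Lemma polyX_coef_neq0 r (K : fieldType) (U : {poly mfps r K}) q m f : (U ^+ q)`_m f != 0 ->
  exists s : seq (nat * 'X_{1..r}), [/\ size s = q, (\sum_(x <- s) x.1)%N = m,
    (\big[+%MM/0%MM]_(x <- s) x.2)%MM = f & forall x, x \in s -> U`_x.1 x.2 != 0].
Proof.
elim: q m f => [|q IH] m f.
  rewrite expr0 coef1; case: (m =P 0%N) => [->|_]; last by rewrite ?mulr0n mfps0E eqxx.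
  rewrite /= mulrb; case: (f =P 0%MM) => [->|_]; last by rewrite eqxx.
  by exists [::]; rewrite !big_nil.
rewrite exprS => /polyfpsM_neq0[i1 [i2 [f1 [f2 [-> -> Uf /IH[s [szs <- <- sU]]]]]]].
exists ((i1, f1) :: s); rewrite !big_cons /= szs; split=> // x.
by rewrite inE => /orP[/eqP->|/sU].
Qed.

Section SeqFamily.
Variable I : choiceType.

Let indicator h : family nat := [fsfun i in [fset i in iota 0 h]%fset => 1%N].

(** The multiplicities of the entries of [s], built from unit families so that [big_family_sum]
    applies. *)
Definition seq_family (x0 : I) (s : seq I) : family I :=
  family_sum (fun i => fdelta (nth x0 s i)) (indicator (size s)).

Lemma big_seq_family (R : Type) (idx : R) (op : Monoid.com_law idx) (F : I -> nat -> R) x0 s :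
  (forall j, F j 0%N = idx) -> (forall j m n, F j (m + n)%N = op (F j m) (F j n)) ->
  \big[op/idx]_(j <- finsupp (seq_family x0 s)) F j (seq_family x0 s j) =
  \big[op/idx]_(j <- s) F j 1%N.
Proof.
move=> F0 FD; rewrite big_family_sum //.
transitivity (\big[op/idx]_(i <- finsupp (indicator (size s)))
   F (nth x0 s i) (indicator (size s) i)).
  by apply: eq_bigr => i _; rewrite finsupp_fdelta big_seq_fset1 fdeltaE eqxx muln1.
rewrite (@big_finsupp _ _ _ _ (fun i n => F (nth x0 s i) n) _ (iota 0 (size s))) ?iota_uniq //.
  rewrite -[in RHS](mkseq_nth x0 s) big_map; apply: eq_big_seq => i.
  by move=> iS; rewrite fsfunE inE iS.
by move=> i; rewrite mem_finsupp fsfunE inE; case: ifP.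
Qed.

Lemma seq_family_sub x0 s : {subset finsupp (seq_family x0 s) <= s}.
Proof.
move=> j; rewrite mem_finsupp family_sumE; apply: contraNT => js; apply/eqP.
rewrite big_seq big1 // => i; rewrite mem_finsupp fsfunE inE mem_iota.
case: ifP => // /andP[_]; rewrite add0n => isz _.
rewrite fdeltaE; case: eqP => [jE|]; last by rewrite muln0.
by rewrite jE mem_nth in js.
Qed.
End SeqFamily.

Section Assembly.
Variables (r dy : nat) (K : fieldType) (P : {poly mfps r K}) (y0 : mfps r K) (k : 'X_{1..r}).
Local Notation fps := (mfps r K).
Local Notation mon := 'X_{1..r}.
Hypothesis charK : [pchar K] =i pred0.
Hypothesis r0 : (0 < r)%N.
Hypothesis szP : (size P <= dy.+1)%N.
Hypothesis Py0 : root P y0.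
Local Notation T := (taylor P y0).
Hypothesis T1 : T`_1 != 0.
Local Notation N := (gsucc k).
Local Notation e := (e1 P y0).
Hypothesis eN : (e < N)%O.
Local Notation om := (T`_1 e).
Local Notation i0 := (ik P y0 k).
Local Notation G := (Grem P y0 k).
Local Notation ok := (eindex_ok P y0 dy k).
Local Notation flat := (@flat r K P y0 k).
Local Notation eterm := (@eterm r K P y0).

Lemma coef_Grem m f : G`_m f = (Gpoly P y0 k)`_m f - om * ((f == i0) && (m == 1%N))%:R.
Proof.
rewrite coefB mfpsDE mfpsNE coefCM coefX.
case: (m =P 1%N) => _; last by rewrite ?mulr0n mulr0 mfps0E andbF mulr0n mulr0.
by rewrite mulr1 mfps_constE andbT.
Qed.

Lemma Grem_fiber m f : (i0 < f)%O -> G`_m f = \sum_(x <- fiber dy P y0 k f m) eterm x.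
Proof.
move=> i0f; rewrite coef_Grem (gt_eqF i0f) mulr0n mulr0 subr0.
by rewrite (coef_Gpoly _ _ r0 szP) big_map big_filter.
Qed.

Lemma flat_gt x : ok x -> zv (flat x) = ix_l x + zv i0 /\ (i0 < flat x)%O.
Proof.
move=> [zl0 zlS _ _ _]; have fE : zv (flat x) = ix_l x + zv i0 by rewrite zabsK.
split=> //; apply: lt_le_trans (lt_gsucc r0 i0) _.
by rewrite -zgrlex_le_zv fE -[zv (gsucc _)](subrK (zv i0)) zgrlex_leD.
Qed.

Definition eindices d : seq (eindex r) :=
  undup (flatten [seq fiber dy P y0 k f m |
    f <- [seq bmnm b | b <- enum {: 'X_{1..r < d.+1}} & (i0 < bmnm b)%O], m <- iota 0 dy.+1]).

Lemma mem_eindices d x : x \in eindices d <-> ok x /\ (mdeg (flat x) <= d)%N.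
Proof.
rewrite mem_undup; split=> [/flattenP[s /allpairsP[[f m] /= [+ _ ->]]]|[xok xd]].
  case/mapP => b; rewrite mem_filter => /andP[i0b _] -> /(mem_fiber dy r0 _ _ i0b)[xok -> _].
  by split=> //; rewrite -ltnS bmdeg.
have [_ i0x] := flat_gt xok; apply/flattenP; exists (fiber dy P y0 k (flat x) (ix_m x)).
  apply/allpairsP; exists (flat x, ix_m x); split=> //.
    have xd' : (mdeg (flat x) < d.+1)%N by [].
    by apply/mapP; exists (BMultinom xd'); rewrite // mem_filter /= i0x mem_enum.
  have [_ _ mle _ _] := xok; rewrite mem_iota /= add0n ltnS.
  by apply: leq_trans mle _; apply: geq_minl.
by apply/(mem_fiber dy r0 _ _ i0x).
Qed.

Definition Gtrunc d : {poly fps} :=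
  \sum_(x <- eindices d) (mfps_const r (eterm x) * mfps_mono K (flat x))%:P * 'X^(ix_m x).

Lemma Grem_agree d : agree d G (Gtrunc d).
Proof.
move=> m f fd; rewrite /Gtrunc coef_sum mfps_sumE.
have E x : ((mfps_const r (eterm x) * mfps_mono K (flat x))%:P * 'X^(ix_m x))`_m f =
    if (flat x == f) && (ix_m x == m) then eterm x else 0.
  rewrite coefCM coefXn; case: (m =P ix_m x) => [->|mx].
    by rewrite mulr1 mfps_constE /= eqxx andbT eq_sym; case: eqP; rewrite ?mulr1 ?mulr0.
  by rewrite mulr0 mfps0E; case: (ix_m x =P m) => [mx'|_]; [case: mx|rewrite andbF].
under eq_bigr => x _ do rewrite E.
rewrite -big_mkcond; have [i0f|fi0] := ltP i0 f.
  rewrite Grem_fiber // -[RHS]big_filter; apply: perm_big; apply: uniq_perm.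
  - exact: fiber_uniq.
  - exact/filter_uniq/undup_uniq.
  move=> x; rewrite mem_filter; apply/idP/andP.
    move=> /(mem_fiber dy r0 _ _ i0f)[xok xf xm]; split; first by rewrite xf xm !eqxx.
    by apply/mem_eindices; rewrite xf.
  by move=> [/andP[/eqP xf /eqP xm] /mem_eindices[xok _]]; apply/(mem_fiber dy r0 _ _ i0f).
(* At or below [i_k] both sides vanish: admissible indices have [flat] above [i_k], and so do the
   exponents of [Grem]. *)
rewrite big_seq_cond big1 => [|x /and3P[/mem_eindices[/flat_gt[_ i0x] _] /eqP xf _]]; last first.
  by move: i0x; rewrite xf ltNge fi0.
by apply: contrapT => /eqP/(Grem_gt r0 Py0 T1 eN); rewrite ltNge fi0.
Qed.

Lemma eindices_uniq d : uniq (eindices d).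
Proof. exact: undup_uniq. Qed.

Definition contributing q F : seq (family (eindex r)) :=
  [seq M <- families (eindices (mdeg F)) q |
     (ydeg M == q.-1) && (mgrade flat M == F)].

(** Each family in the multinomial expansion yields a single monomial; the filter in [contributing]
    keeps those equal to [y^(q-1) u^F]. *)
Lemma Grem_pow_coef q F : (G ^+ q)`_q.-1 F =
  \sum_(M <- contributing q F) (eweight q M)%:R *
    \prod_(x <- finsupp M) (P`_(ix_j x) (ix_i x) * fmono y0 (ix_L x)) ^+ M x.
Proof.
have us := eindices_uniq (mdeg F).
rewrite (agreeX q (@Grem_agree (mdeg F))) // /Gtrunc (multinomial _ _ us).
rewrite coef_sum mfps_sumE big_filter [RHS]big_mkcond big_seq [RHS]big_seq.
apply: eq_bigr => M /(mem_families _ _ us)[Msub cM].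
have -> : \prod_(x <- eindices (mdeg F))
    ((mfps_const r (eterm x) * mfps_mono K (flat x))%:P * 'X^(ix_m x)) ^+ M x =
    (mfps_const r (fmono eterm M) * mfps_mono K (mgrade flat M))%:P * 'X^(ydeg M).
  rewrite -(prod_series _ _ us) // rmorph_prod /=.
  have -> : 'X^(ydeg M) = \prod_(x <- eindices (mdeg F)) 'X^(ix_m x * M x) :> {poly fps}.
    rewrite prodrXr; congr ('X^ _); rewrite /ydeg.
    rewrite (@big_finsupp _ _ _ _ (fun x n => n * ix_m x)%N _ _ us Msub) //.
    by apply: eq_bigr => x _; rewrite mulnC.
  rewrite -big_split; apply: eq_bigr => x _.
  by rewrite exprMn polyC_exp -exprM.
rewrite mulr_natl coefMn mfpsMnE coefCM coefXn eq_sym.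
case: (ydeg M =P q.-1) => _; last by rewrite mulr0 mfps0E mul0rn.
rewrite mulr1 mfps_constE /= eq_sym; case: (_ =P F) => _; last by rewrite mulr0 mul0rn.
rewrite mulr1 /eweight natrM natr_prod -[LHS]mulr_natl -mulrA; congr (_ * _).
rewrite /fmono -big_split; apply: eq_bigr => x _.
by rewrite /eterm exprMn natrX.
Qed.

Variable p : mon.
Hypothesis Np : (N < p)%O.
Local Notation n := (zv p - zv N).
(* [u^n] shifted by the denominator [u^(q i_k)] of the [q]-th power. *)
Definition target q : mon := (e *+ q + p + N *+ q.-1)%MM.

Lemma zv_target q : (0 < q)%N -> zv (target q) = n + zv i0 *+ q.
Proof.
case: q => // q _; apply: (@addIr _ (zv N)); rewrite [RHS]addrAC subrK -zvMn -!zvD.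
rewrite /target (ikN r0 Py0 T1 eN); congr zv.
by apply/mnmP => i; rewrite !(mnmDE, mulmnE) /=; ring.
Qed.

Lemma zv_mgrade_flat M : (forall x, x \in finsupp M -> ok x) ->
  zv (mgrade flat M) = fgrade (@ix_l r) M + zv i0 *+ fcard M.
Proof.
move=> Mok; rewrite zv_mgrade /fgrade /fcard -sumrMnr -big_split big_seq [RHS]big_seq.
by apply: eq_bigr => x /Mok/flat_gt[-> _]; rewrite mulrnDl.
Qed.

Lemma mem_contributing q M : (0 < q)%N -> M \in contributing q (target q) <->
  [/\ admissible P y0 dy k M, fcard M = q, fgrade (@ix_l r) M = n & (ydeg M).+1 = q].
Proof.
move=> q0; have us := eindices_uniq (mdeg (target q)).
rewrite mem_filter.
split=> [/andP[/andP[/eqP ym /eqP gm] /(mem_families _ _ us)[Msub cM]]|[Mok cM lM yM]].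
  have Mok x : x \in finsupp M -> ok x by move=> /Msub/mem_eindices[].
  split=> //; last by rewrite ym prednK.
  apply: (@addIr _ (zv i0 *+ q)); rewrite -zv_target // -gm zv_mgrade_flat //.
  by rewrite cM.
have gm : mgrade flat M = target q.
  by apply: zv_inj; rewrite zv_mgrade_flat // zv_target // lM cM.
rewrite gm -[in X in _ == X]yM !eqxx /=; apply/(mem_families _ _ us); split=> // x xM.
apply/mem_eindices; split; first exact: Mok.
(* Each index of [M] contributes its [flat] exponent to the target, so the truncation degree loses
   no family. *)
rewrite -gm mdeg_sum (big_fsetD1 x) //= mdegMn.
apply: leq_trans (leq_addr _ _); rewrite leq_pmulr // lt0n.
by rewrite mem_finsupp in xM.
Qed.

Lemma Grem_pow_sum q : (0 < q)%N -> (G ^+ q)`_q.-1 (target q) =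
  \sum_(S \in Sindex r dy q)
        fmono (fun x => P`_x.2 x.1) S *
        \sum_(U \in Tindex P y0 k n q S)
          (ecoef P y0 dy k q S U)%:R * fmono y0 U.
Proof.
move=> q0; rewrite Grem_pow_coef; apply/esym/collect_sum => //.
  by apply/filter_uniq/families_uniq/eindices_uniq.
by move=> M; apply: mem_contributing.
Qed.

(** The [y] added in the definition of [b_{l,m}] cancels the linear term [om u^i_k y], which is what
    [Grem] subtracts. *)
Lemma bcoefE l m : bcoef P y0 k l m =
  if zle 0 (l + zv i0) then G`_m (zabs (l + zv i0)) / - om else 0.
Proof.
rewrite /bcoef (omega0N r0 Py0 T1 eN) /laurent_coef -/(Gpoly P y0 k).
case: ifP => [/zabsK|] zl.
  have -> : (l == 0) = (zabs (l + zv i0) == i0).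
    by rewrite -(inj_eq (@zv_inj r)) zl -[RHS]subr_eq0 addrK.
  rewrite coef_Grem mulrBl invrN mulrN [om * _ * _]mulrN opprK mulrAC divff ?mul1r //.
  exact: om_neq0.
rewrite mul0r add0r; case: (l =P 0) => // l0.
by rewrite l0 add0r zle0_zv in zl.
Qed.

(** * The range of summation given by [mu] *)

Local Notation B := (mdeg (e + N)%MM).+1.
Definition zlam (l : zvec r) : int := \sum_(i < r) l i * (gweight B i)%:Z.

Lemma zlamD a b : zlam (a + b) = zlam a + zlam b.
Proof. by rewrite /zlam -big_split; apply: eq_bigr => i _; rewrite ffunE mulrDl. Qed.
Lemma zlam0 : zlam 0 = 0.
Proof. by rewrite /zlam big1 // => i _; rewrite ffunE mul0r. Qed.
Lemma zlamMn a d : zlam (a *+ d) = zlam a *+ d.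
Proof. by elim: d => [|d IH]; rewrite ?mulr0n ?zlam0 // !mulrS zlamD IH. Qed.
Lemma zlam_zv f : zlam (zv f) = (lam B f)%:Z.
Proof.
rewrite /lam -natz natr_sum /zlam; apply: eq_bigr => i _.
by rewrite zvE natz PoszM.
Qed.

Lemma bcoef_zlam l m : bcoef P y0 k l m != 0 -> 1 <= zlam l.
Proof.
rewrite bcoefE; case: ifP => [/zabsK zl|]; last by rewrite eqxx.
rewrite mulf_eq0 negb_or => /andP[/(Grem_gt r0 Py0 T1 eN) lt _].
move: (zabs _) zl lt => f /esym/(canRL (addrK _)) /= -> lt.
have lamlt : (lam B i0 < lam B f)%N.
  by apply: lam_lt lt; rewrite (ikN r0 Py0 T1 eN).
have -> : zlam (zv f - zv i0) = (lam B f)%:Z - (lam B i0)%:Z.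
  by rewrite -!zlam_zv -[in RHS](subrK (zv i0) (zv f)) [in RHS]zlamD addrK.
by rewrite lerBrDr -PoszD lez_nat add1n.
Qed.

Definition muset : set nat := [set m : nat | exists M : family (zvec r * nat)%type,
    [/\ forall x, x \in finsupp M -> bcoef P y0 k x.1 x.2 != 0,
        fcard M = m, (fnorm M).+1 = m & fgrade (fun x => x.1) M = n]]%classic.

(** Every index with a nonzero coefficient adds at least 1 to [zlam n], so the set is bounded and
    [mu] is a true maximum as soon as it is nonempty. *)
Lemma muset_bound m : muset m -> (m <= `|zlam n|)%N.
Proof.
move=> [M [Mb <- _ gM]].
have : ((fcard M)%:Z <= zlam n).
  rewrite -gM /fgrade (big_morph zlam zlamD zlam0) /fcard -natz natr_sum.
  rewrite big_seq [X in _ <= X]big_seq; apply: ler_sum => x /Mb/bcoef_zlam zx.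
  by rewrite zlamMn natz -mulr_natr natz; clear szP; nia.
by clear szP; lia.
Qed.

(** A nonzero coefficient of the [q]-th power comes from [q] monomials of [Grem]; their
    multiplicities form the family required by [mu]. *)
Lemma muset_mem q : (0 < q)%N -> (G ^+ q)`_q.-1 (target q) != 0 -> muset q.
Proof.
move=> q0 /polyX_coef_neq0[s [szs s1 s2 sG]].
pose g (x : nat * mon) : zvec r * nat := (zv x.2 - zv i0, x.1).
pose M := seq_family (0 : zvec r, 0%N) (map g s).
exists M; split.
- move=> x /seq_family_sub/mapP[[j f] /sG /= jf ->] /=.
  rewrite bcoefE subrK zle0_zv zvK mulf_neq0 // invr_eq0 oppr_eq0.
  exact: om_neq0.
- by rewrite /fcard (@big_seq_family _ _ _ _ (fun _ n => n)) // big_map sum1_size.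
- rewrite /fnorm (@big_seq_family _ _ _ _ (fun x n => x.2 * n)%N) //.
  + rewrite big_map -[RHS](prednK q0) -s1; congr S.
    by apply: eq_bigr => x _; rewrite muln1.
  + by move=> j; rewrite muln0.
  + by move=> j a b; rewrite mulnDr.
- rewrite /fgrade (@big_seq_family _ _ _ _ (fun x n => x.1 *+ n)) //; last first.
    by move=> j a b; rewrite mulrnDr.
  rewrite big_map (eq_bigr (fun x => zv x.2 - zv i0)) // sumrB.
  rewrite -(big_morph (@zv r) (@zvD r) (zv0 r)) s2 zv_target //.
  rewrite big_const_seq count_predT szs iter_addr_0.
  by rewrite addrK.
Qed.

Lemma Grem_pow_vanish q : (mu P y0 k n < q)%N -> (G ^+ q)`_q.-1 (target q) = 0.
Proof.
move=> muq; apply: contrapT => /eqP/muset_mem-/(_ (leq_ltn_trans (leq0n _) muq)) Aq.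
have [_ /(_ _ Aq)] := greatest_eq (ex_intro _ _ Aq) muset_bound.
by rewrite leqNgt muq.
Qed.

Lemma root_coef_mu : y0 p =
  \sum_(1 <= q < (mu P y0 k n).+1) q%:R^-1 * (-1 / om) ^+ q * (G ^+ q)`_q.-1 (target q).
Proof.
(* Large enough both for the inversion formula and to contain the range up to [mu]; the terms beyond
   [mu] vanish. *)
pose M := (mu P y0 k n + lam B p).+1.
rewrite (root_coef charK r0 Py0 T1 eN Np (M := M)) //; last by rewrite /M; clear szP; lia.
rewrite (big_cat_nat _ (n := (mu P y0 k n).+1)) //=; last by rewrite /M; clear szP; lia.
rewrite [X in _ + X]big_nat_cond [X in _ + X]big1 ?addr0.
  apply: eq_big_nat => q /andP[q0 _]; rewrite (Grem_pow r0 Py0 T1 eN) // mulrA; congr (_ * _).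
  by rewrite -mulrA -exprMn [om^-1 * _]mulrC.
move=> q; rewrite andbT => /andP[muq _].
by rewrite (Grem_pow r0 Py0 T1 eN) ?Grem_pow_vanish ?mulr0 // (leq_ltn_trans _ muq).
Qed.
End Assembly.

Theorem corollary7p7 (K : fieldType) (r dy : nat)
    (P : {poly mfps r K}) (y0 : mfps r K)
    (Kbar : closedFieldType) (iota : {rmorphism fpsfrac r K -> Kbar})
    (k p : 'X_{1..r}) :
  [pchar K] =i pred0 ->
  (2 <= r)%N ->
  P != 0 ->
  (size P <= dy.+1)%N ->
  is_algebraic_closure iota ->
  only_simple_roots iota P ->
  root P y0 ->
  y0 0%MM != 0 ->
  ~ is_mpoly y0 ->
  (ord (resultant P P^`()) + 1 <= mdeg k)%N ->
  (gsucc k < p)%O ->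
  let n := zv p - zv (gsucc k) in
  y0 p =
    \sum_(1 <= q < (mu P y0 k n).+1)
      q%:R^-1 * (-1 / omega0 P y0) ^+ q *
      \sum_(S \in Sindex r dy q)
        fmono (fun x => P`_x.2 x.1) S *
        \sum_(T \in Tindex P y0 k n q S)
          (ecoef P y0 dy k q S T)%:R * fmono y0 T.
Proof.
move=> charK r2 P0 szP _ simpleP Py0 _ _ kord Np n.
have r0 : (0 < r)%N by apply: leq_trans r2.
have T1 : (taylor P y0)`_1 != 0 by rewrite taylor1 (deriv_root_neq0 P0 simpleP Py0).
(* The degree of [e1] is at most the order of the resultant, hence below that of [k]. *)
have eN : (e1 P y0 < gsucc k)%O.
  apply: lt_trans (lt_gsucc r0 k); apply: lt_mdeg_ltmc.
  rewrite /e1 taylor1; apply: leq_ltn_trans (mdeg_w_deriv_le P0 simpleP Py0) _.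
  by rewrite -addn1.
rewrite (root_coef_mu charK r0 Py0 T1 eN Np) -/n (omega0N r0 Py0 T1 eN).
apply: eq_big_nat => q /andP[q0 _]; congr (_ * _).
exact: Grem_pow_sum.
Qed.
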